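(* Let $p$ be an odd prime, $q=p^k$, $r=p^s$ with $s\mid k$, let $n$ be even with $s\le n/2$, let $V_n$ be an $n$-dimensional $\mathbb{F}_p$-vector space with a nondegenerate symmetric bilinear form, and let $K_0$ be an $\mathbb{F}_r$-subspace of $\mathbb{F}_q$. Put $K_1=\mathbb{F}_q\setminus K_0$ and $K_0^\perp=\{y\in\mathbb{F}_q:\mathrm{Tr}^k_1(zy)=0\ \forall z\in K_0\}$. Let $(P^{(z)})_{z\in\mathbb{F}_q}$ be a family of functions $V_n\to\mathbb{F}_r$ such that: (1) $P^{(cz)}=P^{(z)}$ for all $z\in\mathbb{F}_q$ and $c\in\mathbb{F}_r^*$; (2) every $P^{(z)}$ is vectorial bent with weakly regular components, with sign pattern $(\varepsilon_{z,t})_{t\in\mathbb{F}_r^*}$; for every $z\neq0$, $P^{(z)}$ is of inversion type, with $G^{(z)}\colon V_n\to\mathbb{F}_r$ such that $(P^{(z)}_t)^*=\mathrm{Tr}^s_1(t^{-1}G^{(z)})$ for all $t\in\mathbb{F}_r^*$; and $P^{(0)}$ is vectorial dual-bent, with $G^{(0)}\colon V_n\to\mathbb{F}_r$ vectorial bent and $\sigma_0$ a permutation of $\mathbb{F}_r^*$ such that $(P^{(0)}_t)^*=\mathrm{Tr}^s_1(\sigma_0(t)G^{(0)})$ for all $t\in\mathbb{F}_r^*$; (3) there are fixed sign patterns $(\varepsilon_{1,t})_{t\in\mathbb{F}_r^*}$, $(\varepsilon_{2,t})_{t\in\mathbb{F}_r^*}$ such that for all $t$ one has $\varepsilon_{z,t}=\varepsilon_{1,t}$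 for all $z\in K_1$ and $\varepsilon_{z,t}=\varepsilon_{2,t}$ for all $z\in K_0\setminus\{0\}$ (here $\varepsilon_{1,t},\varepsilon_{2,t}$ are just names for two fixed patterns); (4) $P^{(0)}(0)=0$ and $G^{(0)}(0)=0$, i.e. $W_{P^{(0)}_t}(0)=\varepsilon_{0,t}\,p^{n/2}$ for all $t\in\mathbb{F}_r^*$. Let $H\colon V=V_n\times\mathbb{F}_q\times\mathbb{F}_q\to\mathbb{F}_r$, $H(x,y,z)=P^{(z)}(x)+\mathrm{Tr}^k_s(yz)$, and let $\Omega(H,K_0)$ be the partition of $V$ defined in the context. Then $\Omega(H,K_0)$ is Fourier-reflexive, with dual partition $\Omega(K,K_0)$ with the roles of the second and third coordinates interchanged, where $K(u,v,w)=G^{(v)}(u)-\mathrm{Tr}^k_s(vw)$; that is, the dual partition consists of the nonempty sets among $\{0\}$, $\{(0,0,c): c\in K_0^\perp\setminus\{0\}\}$, $\{(0,0,c): c\notin K_0^\perp\}$, $\{(a,0,c): a\ne0, G^{(0)}(a)=i\}$, $\{(a,b,c): b\in K_0\setminus\{0\}, K(a,b,c)=i\}$, $\{(a,b,c): b\in K_1, K(a,b,c)=i\}$ ($i\in\mathbb{F}_r$). Moreover, provided all $P^{(z)}$ are even (i.e. $P^{(z)}(-x)=P^{(z)}(x)$), $\Omega(H,K_0)$ induces a symmetric association scheme with $$|\Omega(H,K_0)|-1=\begin{cases}2r+\delta&\text{if }K_0=\{0\}\text{ or }K_0=\mathbb{F}_q,\\ 3r+1+\delta&\text{otherwise}\end{cases}$$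 classes, where $\delta=0$ if $n=2s$ and $\varepsilon_{0,t}=-1$ for all $t\in\mathbb{F}_r^*$, and $\delta=1$ otherwise.
   Context: Notation: $\mathrm{Tr}^a_b$ is the trace $\mathbb{F}_{p^a}\to\mathbb{F}_{p^b}$ ($b\mid a$); $\zeta_p=e^{2\pi i/p}$. For an even-dimensional $\mathbb{F}_p$-space $V_n$ of dimension $n$ with nondegenerate symmetric bilinear form $\langle\cdot,\cdot\rangle$ and $f\colon V_n\to\mathbb{F}_p$, the Walsh transform is $W_f(b)=\sum_{x\in V_n}\zeta_p^{f(x)-\langle b,x\rangle}$. $f$ is bent if $|W_f(b)|=p^{n/2}$ for all $b$; then (as $n$ is even) $W_f(b)=\varepsilon_f(b)p^{n/2}\zeta_p^{f^*(b)}$ with $\varepsilon_f(b)\in\{\pm1\}$ and a function $f^*\colon V_n\to\mathbb{F}_p$, the dual of $f$. A bent $f$ is weakly regular if $\varepsilon_f$ is constant (this constant is its sign). For $P\colon V_n\to\mathbb{F}_r$ and $t\in\mathbb{F}_r^*$ the component is $P_t=\mathrm{Tr}^s_1(tP)$. $P$ is vectorial bent if all $P_t$, $t\ne0$, are bent; it has weakly regular components if every $P_t$ is weakly regular, with sign $\varepsilon_{P,t}$; $(\varepsilon_{P,t})_{t\in\mathbb{F}_r^*}$ is its sign pattern. $P$ is vectorial dual-bent if there are a vectorial bent $P^*\colon V_n\to\mathbb{F}_r$ and a permutation $\sigma$ of $\mathbb{F}_r^*$ with $(P_t)^*=(P^* )_{\sigma(t)}$ for all $t\in\mathbb{F}_r^*$.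 A vectorial bent $P$ is of inversion type if there is $G\colon V_n\to\mathbb{F}_r$ with $(P_t)^*=\mathrm{Tr}^s_1(t^{-1}G)$ for all $t\in\mathbb{F}_r^*$. In hypothesis (3), the second condition is void if $K_0=\{0\}$ and the first is void if $K_0=\mathbb{F}_q$. $V=V_n\times\mathbb{F}_q\times\mathbb{F}_q$ carries the form $\langle(u,v,w),(x,y,z)\rangle=\langle u,x\rangle+\mathrm{Tr}^k_1(vy)+\mathrm{Tr}^k_1(wz)$. The partition $\Omega(H,K_0)$: for $i\in\mathbb{F}_r$ put $c_i=\{(x,y,z): z\in K_1, H(x,y,z)=i\}$, $d_i=\{(x,y,z): z\in K_0\setminus\{0\}, H(x,y,z)=i\}$, $e_i=\{(x,y,0): x\neq0, P^{(0)}(x)=i\}$, $B_1=\{(0,y,0): y\in K_0^\perp\setminus\{0\}\}$, $B_2=\{(0,y,0): y\in\mathbb{F}_q\setminus K_0^\perp\}$. Then $\Omega(H,K_0)=\{\{0\},B_1,B_2,e_i,d_i,c_i\ (i\in\mathbb{F}_r)\}$ with empty cells omitted. Fourier-reflexivity: for $\xi\in V$ and $S\subseteq V$ let $\chi_\xi(S)=\sum_{s\in S}\zeta_p^{-\langle\xi,s\rangle}$. The dual partition $\widehat\Omega$ of a partition $\Omega=\{\{0\},U_1,\dots,U_d\}$ of $V$ (with $U_0=\{0\}$) is the partition of $V$ into the level sets of $\xi\mapsto(\chi_\xi(U_0),\dots,\chi_\xi(U_d))$; $\Omega$ is Fourier-reflexive if $|\widehat\Omega|=|\Omega|$. $\Omega$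 induces an association scheme if the relations $R_0=\{(x,x)\}$, $R_i=\{(x,y): y-x\in U_i\}$ form a ($d$-class) association scheme on $V$. *)

(* Defs.v *)
From HB Require Import structures.
From mathcomp Require Import all_boot all_order all_fingroup all_algebra all_field.
From mathcomp Require Import sesquilinear.

Set Implicit Arguments.
Unset Strict Implicit.
Unset Printing Implicit Defensive.

Import Order.TTheory GRing.Theory Num.Theory.
Local Open Scope ring_scope.

(* p.-root (-1) is the p-th root of -1 of least argument, i.e. e^(i pi / p),
   so its square is e^(2 i pi / p). *)
Definition zeta (p : nat) : algC := p.-root (-1) ^+ 2.

Lemma zeta_prim (p : nat) : prime p -> p.-primitive_root (zeta p).
Proof.
move=> p_pr; have p_gt0 := prime_gt0 p_pr.
have zp1 : zeta p ^+ p = 1 by rewrite exprAC rootCK // sqrrN expr1n.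
have [m prim_m m_dvd_p] := prim_order_exists p_gt0 zp1.
have [_ /(_ m m_dvd_p)] := primeP p_pr.
case/orP=> /eqP Dm; last by rewrite Dm in prim_m.
have /eqP := prim_expr_order prim_m; rewrite Dm expr1 /zeta sqrf_eq1.
case/orP=> /eqP root_eq.
  have /eqP := rootCK p_gt0 (-1 : algC).
  by rewrite root_eq expr1n -subr_eq0 opprK -(natrD _ 1 1) pnatr_eq0.
have := rootC_lt0 (-1 : algC) (prime_gt1 p_pr).
by rewrite root_eq oppr_lt0 ltr01.
Qed.

(* The trace of an extension F / E of finite fields of degree m, along an
   embedding emb : E -> F: the unique c in E whose image is the sum of the
   conjugates x ^ (#|E| ^ i), i < m, of x. *)
Definition ftrace (E : finFieldType) (F : fieldType) (emb : E -> F) (m : nat)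
    (x : F) : E :=
  odflt 0 [pick c : E | emb c == \sum_(i < m) x ^+ (#|E| ^ i)].

(* Tr^k_1 on a field F with p ^ k elements; c |-> c%:R is the embedding of the
   prime field into F. *)
Definition abs_trace (p : nat) (F : fieldType) (k : nat) : F -> 'F_p :=
  ftrace (fun c : 'F_p => (c : nat)%:R : F) k.

Definition rel_trace (E : finFieldType) (F : fieldExtType E) (m : nat) :
    F -> E :=
  ftrace (fun c : E => c%:A : F) m.

Section Bent.

Variables (p : nat) (V : vectType 'F_p) (form : {symmetric V}).
Local Notation vT := (finvect_type V).
Implicit Types (f fs : vT -> 'F_p) (b x : vT).

Definition walsh f b : algC := \sum_(x : vT) zeta p ^+ (f x - form b x)%R.

(* p ^ (n / 2), for n = \dim V even *)
Definition bent_abs : algC := (p ^ (\dim {:V})./2)%:R.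

Definition bent f : Prop := forall b, `|walsh f b| = bent_abs.

Definition dual_with_signs f (eps : vT -> int) fs : Prop :=
  forall b, (eps b = 1 \/ eps b = -1) /\
    walsh f b = (eps b)%:~R * bent_abs * zeta p ^+ fs b.

(* fs is the dual f^* of f *)
Definition is_dual f fs : Prop := exists eps, dual_with_signs f eps fs.

Definition weakly_regular f (e : int) : Prop :=
  bent f /\ exists fs, dual_with_signs f (fun=> e) fs.

Variables (s : nat) (Fr : finFieldType).
Implicit Types (P G : vT -> Fr) (t : {unit Fr}).

Definition component P (t : Fr) : vT -> 'F_p :=
  fun x => abs_trace p s (t * P x).

Definition vectorial_bent P : Prop := forall t, bent (component P (val t)).

Definition weakly_regular_components P (eps : {unit Fr} -> int) : Prop :=
  forall t, weakly_regular (component P (val t)) (eps t).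

Definition vectorial_dual_bent P Ps (sigma : {perm {unit Fr}}) : Prop :=
  [/\ vectorial_bent P, vectorial_bent Ps &
      forall t, is_dual (component P (val t)) (component Ps (val (sigma t)))].

Definition inversion_type P G : Prop :=
  vectorial_bent P /\
  forall t, is_dual (component P (val t)) (component G (val t)^-1).

End Bent.

Section FourierReflexive.

Variables (p : nat) (T : finZmodType) (pairing : T -> T -> 'F_p).
Implicit Types (S U : {set T}) (Omega : {set {set T}}).

Definition chi (xi : T) S : algC := \sum_(u in S) zeta p ^+ (- pairing xi u)%R.

Definition dual_partition Omega : {set {set T}} :=
  equivalence_partition
    (fun xi eta => [forall U in Omega, chi xi U == chi eta U]) [set: T].

Definition fourier_reflexive Omega : Prop :=
  [/\ partition Omega [set: T], [set 0] \in Omega &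
      #|dual_partition Omega| = #|Omega|].

End FourierReflexive.

Section AssociationScheme.

Variable X : finType.
Implicit Types (R S U : {set X * X}) (Rs : {set {set X * X}}).

Definition transpose_rel R : {set X * X} := [set u | (u.2, u.1) \in R].

Definition path_count R S (u : X * X) : nat :=
  #|[set z : X | ((u.1, z) \in R) && ((z, u.2) \in S)]|.

(* d-class association schemes *)
Definition association_scheme (d : nat) Rs : Prop :=
  [/\ partition Rs [set: X * X] /\ #|Rs| = d.+1,
      [set u : X * X | u.1 == u.2] \in Rs,
      forall R, R \in Rs -> transpose_rel R \in Rs,
      forall R S U u v, R \in Rs -> S \in Rs -> U \in Rs ->
        u \in U -> v \in U -> path_count R S u = path_count R S v
    & forall R S u, R \in Rs -> S \in Rs -> path_count R S u = path_count S R u].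

Definition symmetric_association_scheme (d : nat) Rs : Prop :=
  association_scheme d Rs /\ forall R, R \in Rs -> transpose_rel R = R.

End AssociationScheme.

Definition difference_rel (T : finZmodType) (U : {set T}) : {set T * T} :=
  [set u | u.2 - u.1 \in U].

Definition induced_relations (T : finZmodType) (Omega : {set {set T}}) :
    {set {set T * T}} :=
  [set difference_rel U | U in Omega].

Section Construction.

Variables (p k s : nat) (Fr : finFieldType) (Fq : fieldExtType Fr).
Variables (V : vectType 'F_p) (form : {symmetric V}) (K0 : {vspace Fq}).
Local Notation vT := (finvect_type V).
Local Notation qT := (finvect_type Fq).

(* The ambient space V_n x F_q x F_q, with the vector-space factors as finite
   types. *)
Definition ambient : predArgType := (vT * qT * qT)%type.
HB.instance Definition _ := GRing.Zmodule.on ambient.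
HB.instance Definition _ := Finite.on ambient.
Implicit Types (P G : qT -> vT -> Fr) (i : Fr).

Definition ambient_form (a b : ambient) : 'F_p :=
  let: (u, v, w) := a in let: (x, y, z) := b in
  form u x + abs_trace p k (v * y : Fq) + abs_trace p k (w * z : Fq).

Definition perp : {set qT} :=
  [set y : qT | [forall z : qT, (z \in K0) ==> (abs_trace p k (z * y : Fq) == 0)]].

Definition Hfun P (a : ambient) : Fr :=
  let: (x, y, z) := a in P z x + rel_trace (k %/ s) (y * z : Fq).

Definition Kfun G (a : ambient) : Fr :=
  let: (u, v, w) := a in G v u - rel_trace (k %/ s) (v * w : Fq).

Definition OmegaH P : {set {set ambient}} :=
  let B1 := [set a : ambient | let: (x, y, z) := a in
               [&& x == 0, z == 0, y \in perp & y != 0]] in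
  let B2 := [set a : ambient | let: (x, y, z) := a in
               [&& x == 0, z == 0 & y \notin perp]] in
  let e i := [set a : ambient | let: (x, y, z) := a in
               [&& z == 0, x != 0 & P 0 x == i]] in
  let d i := [set a : ambient | let: (x, y, z) := a in
               [&& z \in K0, z != 0 & Hfun P a == i]] in
  let c i := [set a : ambient | let: (x, y, z) := a in
               (z \notin K0) && (Hfun P a == i)] in
  ([set [set 0]; B1; B2] :|: [set e i | i : Fr] :|: [set d i | i : Fr]
    :|: [set c i | i : Fr]) :\ set0.

(* Omega(K, K_0) with the last two coordinates exchanged *)
Definition OmegaK G : {set {set ambient}} :=
  let B1 := [set a : ambient | let: (u, v, w) := a in
               [&& u == 0, v == 0, w \in perp & w != 0]] in
  let B2 := [set a : ambient | let: (u, v, w) := a in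
               [&& u == 0, v == 0 & w \notin perp]] in
  let e i := [set a : ambient | let: (u, v, w) := a in
               [&& v == 0, u != 0 & G 0 u == i]] in
  let d i := [set a : ambient | let: (u, v, w) := a in
               [&& v \in K0, v != 0 & Kfun G a == i]] in
  let c i := [set a : ambient | let: (u, v, w) := a in
               (v \notin K0) && (Kfun G a == i)] in
  ([set [set 0]; B1; B2] :|: [set e i | i : Fr] :|: [set d i | i : Fr]
    :|: [set c i | i : Fr]) :\ set0.

End Construction.

(* Main.v *)
(* A function on V is determined by the character sums of its weighted level
   sets, so the cells {H = i} over a region of z may be replaced by the sums
   X(xi, t) of e(t H(a)) psi(-<xi, a>), t in F_r, where e = psi o Tr^s_1.
   Summing over y forces v = t z; hypothesis (1) turns what is left into the
   Walsh transform of P^(v)_t, and inversion type makes the result depend on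
   xi = (u, v, w) only through e(K(xi) / t), which for all t together is the
   value K(xi).  The cells B_1 and B_2 detect whether v lies in K_0 and whether
   it is 0, so two characters agree on all cells of Omega(H, K_0) exactly when
   they lie in the same cell of Omega(K, K_0).  The two partitions have equally
   many cells because P^(0) and G^(0) take the same number of values on nonzero
   arguments, which is read off the fibre sizes given by the values of the Walsh
   transforms at 0.

   For the association scheme, the square matrix of character values
   (cells against dual cells) is invertible by Fourier inversion; hence a
   product of two of its rows is a combination of rows, i.e. the convolution
   of two cells is constant on every cell. *)

Require Import Defs.
From mathcomp Require Import all_boot all_order all_fingroup all_algebra all_field.
From mathcomp Require Import sesquilinear zify ring.

Set Implicit Arguments.
Unset Strict Implicit.
Unset Printing Implicit Defensive.

Import Order.TTheory GRing.Theory Num.Theory.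
Local Open Scope ring_scope.

(** * Traces of finite fields *)

Section FieldTrace.

Variables (E F : finFieldType) (emb : E -> F) (m p a : nat).
Hypotheses (embD : {morph emb : x y / x + y}) (embM : {morph emb : x y / x * y}).
Hypotheses (emb1 : emb 1 = 1) (m_gt0 : (0 < m)%N).
Hypotheses (p_prime : prime p) (card_E : #|E| = (p ^ a)%N).
Hypothesis card_F : #|F| = (#|E| ^ m)%N.

Let emb0 : emb 0 = 0.
Proof. by apply: (addrI (emb 0)); rewrite -embD !addr0. Qed.

Let embX n : {morph emb : x / x ^+ n}.
Proof. by move=> x; elim: n => [|n IH]; rewrite ?expr0 ?emb1 // !exprS embM IH. Qed.

Let emb_eq0 x : (emb x == 0) = (x == 0).
Proof.
have [->|x_neq0] := eqVneq x 0; first by rewrite emb0 eqxx.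
apply/eqP=> ex0; move: (oner_neq0 F); rewrite -emb1 -(mulfV x_neq0) embM ex0.
by rewrite mul0r eqxx.
Qed.

Let emb_inj : injective emb.
Proof.
move=> x y exy; apply/eqP; rewrite -subr_eq0 -emb_eq0 embD exy -embD subrr.
by rewrite emb0.
Qed.

Let pcharF : p \in [pchar F].
Proof. by apply: (@card_finPcharP _ _ (a * m)); rewrite // card_F card_E expnM. Qed.

Let frobD : {morph (fun x : F => x ^+ #|E|) : x y / x + y}.
Proof.
move=> x y /=; rewrite exprDn_pchar // card_E pnatX.
by rewrite (eq_pnat _ (pcharf_eq pcharF)) pnat_id.
Qed.

(** The polynomial ['X^#|E| - 'X] has at most [#|E|] roots, and the image of [emb] already supplies
    that many, so no further fixed point exists. *)
Lemma fixed_frobenius_image (y : F) : y ^+ #|E| = y -> exists c, emb c = y.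
Proof.
move=> y_fix; have [/existsP[c /eqP <-]|] := boolP [exists c, emb c == y].
  by exists c.
rewrite negb_exists => /forallP/= y_notin.
pose q : {poly F} := 'X^#|E| - 'X.
have E_gt1 : (1 < #|E|)%N := finNzRing_gt1 E.
have sz_q : size q = #|E|.+1.
  by rewrite size_polyDl size_polyXn // size_polyN size_polyX.
have q_neq0 : q != 0 by rewrite -size_poly_eq0 sz_q.
have /= := max_poly_roots q_neq0 (rs := y :: [seq emb c | c : E]).
rewrite sz_q /= size_map -cardT ltnn => absurd; suff: false by [].
apply: absurd.
  apply/andP; split; first by rewrite rootE !hornerE y_fix subrr.
  by apply/allP=> z /mapP[c _ ->]; rewrite rootE !hornerE -embX expf_card subrr.
rewrite map_inj_uniq // enum_uniq andbT; apply/mapP=> -[c _ y_c].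
by have := y_notin c; rewrite y_c eqxx.
Qed.

(** The default 0 in [ftrace] is never taken: raising to the power [#|E|] permutes the conjugates
    cyclically, so their sum is fixed and has a preimage under [emb]. *)
Lemma ftraceE (x : F) : emb (ftrace emb m x) = \sum_(i < m) x ^+ (#|E| ^ i).
Proof.
rewrite /ftrace; case: pickP => [c /eqP //|no_c] /=.
have [c /eqP] : exists c, emb c = \sum_(i < m) x ^+ (#|E| ^ i);
  last by rewrite no_c.
apply: fixed_frobenius_image.
rewrite (big_morph _ frobD (_ : 0 ^+ #|E| = 0)); last first.
  by rewrite expr0n gtn_eqF // ltnW // finNzRing_gt1.
rewrite -(prednK m_gt0) [RHS]big_ord_recl big_ord_recr /= addrC expn0 expr1.
rewrite -exprM -expnSr prednK // -card_F expf_card; congr (_ + _).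
by apply: eq_bigr => i _; rewrite -exprM -expnSr.
Qed.

Lemma ftraceD : {morph ftrace emb m : x y / x + y}.
Proof.
have frobXD i : {morph (fun x : F => x ^+ (#|E| ^ i)) : x y / x + y}.
  by elim: i => [|i IH] x y //=; rewrite expnSr !exprM IH frobD.
move=> x y; apply: emb_inj; rewrite embD !ftraceE -big_split /=.
by apply: eq_bigr => i _; rewrite frobXD.
Qed.

Lemma ftraceZ c x : ftrace emb m (emb c * x) = c * ftrace emb m x.
Proof.
apply: emb_inj; rewrite embM !ftraceE mulr_sumr; apply: eq_bigr => i _.
rewrite exprMn; congr (_ * _).
by elim: (val i) => [|j IH] //; rewrite expnSr exprM IH -embX expf_card.
Qed.

(** Otherwise every element of [F] would be a root of the trace polynomial [q], whose degree is
    below [#|F|]. It is nonzero because only [i = 0] contributes to the coefficient of ['X]. *)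
Lemma ftrace_neq0 : exists x, ftrace emb m x != 0.
Proof.
have [/existsP//|] := boolP [exists x, ftrace emb m x != 0].
rewrite negb_exists => /forallP/= tr0.
have E_gt1 : (1 < #|E|)%N := finNzRing_gt1 E.
pose q : {poly F} := \sum_(i < m) 'X^(#|E| ^ i).
have q1 : q`_1 = 1.
  rewrite coef_sum (bigD1 (Ordinal m_gt0)) //= coefXn eqxx big1 ?addr0 // => i.
  by rewrite -val_eqE /= coefXn -{1}(expn0 #|E|) eqn_exp2l // eq_sym => /negPf->.
have q_neq0 : q != 0.
  by apply/eqP=> q0; have := oner_neq0 F; rewrite -q1 q0 coef0 eqxx.
have := max_poly_roots q_neq0 (rs := enum F).
rewrite -cardT => /(_ _ (enum_uniq _)) absurd.
suff: false by []; move: absurd; rewrite ltnNge (_ : _ <= _)%N; last first.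
  apply: leq_trans (size_sum _ _ _) _; apply/bigmax_leqP=> i _.
  by rewrite size_polyXn card_F ltn_exp2l.
apply; apply/allP=> x _; rewrite rootE horner_sum.
under eq_bigr do rewrite hornerXn.
by rewrite -ftraceE emb_eq0; have := tr0 x; rewrite negbK.
Qed.

Lemma ftrace_nondegenerate x : x != 0 -> exists y, ftrace emb m (y * x) != 0.
Proof.
move=> x_neq0; have [y tr_y] := ftrace_neq0.
by exists (y / x); rewrite divfK.
Qed.

End FieldTrace.

Section AbsoluteTrace.

Variables (p : nat) (p_prime : prime p) (F : finFieldType) (m : nat).
Hypotheses (m_gt0 : (0 < m)%N) (card_F : #|F| = (p ^ m)%N).

Let emb (c : 'F_p) : F := (c : nat)%:R.

Let pcharF : p \in [pchar F]. Proof. exact: card_finPcharP card_F p_prime. Qed.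

(** The modulus built into ['F_p] is [(Zp_trunc (pdiv p)).+2], which is [p] only by primality;
    multiples of [p] then vanish in [F]. *)
Let natr_mod n : (n %% (Zp_trunc (pdiv p)).+2)%:R = n%:R :> F.
Proof.
by rewrite Fp_cast // [in RHS](divn_eq n p) natrD natrM (pcharf0 pcharF) mulr0 add0r.
Qed.

Let embD : {morph emb : x y / x + y}.
Proof. by move=> x y; rewrite /emb /= natr_mod natrD. Qed.

Let embM : {morph emb : x y / x * y}.
Proof. by move=> x y; rewrite /emb /= natr_mod natrM. Qed.

Let card_Fp1 : #|'F_p| = (p ^ 1)%N. Proof. by rewrite card_Fp ?expn1. Qed.

Let card_FE : #|F| = (#|'F_p| ^ m)%N. Proof. by rewrite card_Fp. Qed.

Lemma abs_traceE (x : F) :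
  (abs_trace p m x : nat)%:R = \sum_(i < m) x ^+ (p ^ i).
Proof.
transitivity (\sum_(i < m) x ^+ (#|'F_p| ^ i)); last by rewrite card_Fp.
exact: (ftraceE embD embM (erefl _) m_gt0 p_prime card_Fp1 card_FE).
Qed.

Lemma abs_trace_emb_inj (c d : 'F_p) : (c : nat)%:R = (d : nat)%:R :> F -> c = d.
Proof.
move=> ecd; apply/eqP; rewrite -subr_eq0; apply/eqP/val_inj => /=.
have : emb (c - d) == 0.
  by apply/eqP/(addIr (emb d)); rewrite -embD subrK add0r.
rewrite /emb -(dvdn_pcharf pcharF) => p_dvd.
have lt_p : (val (c - d)%R < p)%N by rewrite -[ltnRHS](Fp_cast p_prime) ltn_ord.
by apply/eqP; rewrite eqn0Ngt; apply: contraTN p_dvd => cd_gt0; rewrite gtnNdvd.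
Qed.

Lemma abs_traceD : {morph @abs_trace p F m : x y / x + y}.
Proof. exact: (ftraceD embD embM (erefl _) m_gt0 p_prime card_Fp1 card_FE). Qed.

Lemma abs_trace_nondegenerate (x : F) :
  x != 0 -> exists y, abs_trace p m (y * x : F) != 0.
Proof.
exact: (ftrace_nondegenerate embD embM (erefl _) m_gt0 p_prime card_Fp1 card_FE).
Qed.

End AbsoluteTrace.

(** Grouping the exponents by their residue modulo [s] is the regrouping of Frobenius powers behind
    transitivity of the trace. *)
Lemma sum_ord_mul (R : nmodType) (s m : nat) (f : nat -> R) :
  \sum_(i < s * m) f i = \sum_(j < s) \sum_(i < m) f (s * i + j)%N.
Proof.
elim: m => [|m IH].
  by rewrite muln0 big_ord0 [RHS]big1 // => j _; rewrite big_ord0.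
rewrite mulnSr big_split_ord /= IH -big_split /=.
by apply: eq_bigr => j _; rewrite big_ord_recr.
Qed.

Section RelativeTrace.

Variables (p : nat) (p_prime : prime p) (s m : nat).
Variables (E : finFieldType) (L : fieldExtType E).
Hypotheses (s_gt0 : (0 < s)%N) (m_gt0 : (0 < m)%N).
Hypotheses (card_E : #|E| = (p ^ s)%N).
Hypothesis card_L : #|finvect_type L| = (p ^ (s * m))%N.

Let emb (c : E) : finvect_type L := c%:A.
Let embD : {morph emb : x y / x + y}. Proof. by move=> x y; apply: scalerDl. Qed.
Let embM : {morph emb : x y / x * y}.
Proof. by move=> x y; rewrite /emb -[RHS]scalerAl mul1r scalerA. Qed.
Let emb1 : emb 1 = 1. Proof. exact: scale1r. Qed.
Let card_LE : #|finvect_type L| = (#|E| ^ m)%N.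
Proof. by rewrite card_L card_E expnM. Qed.

Lemma rel_traceZ (c : E) (x : L) : rel_trace m (c *: x) = c * rel_trace m x.
Proof.
have -> : c *: x = emb c * x by rewrite /emb -[RHS]scalerAl mul1r.
exact: (ftraceZ embD embM emb1 m_gt0 p_prime card_E card_LE).
Qed.

Lemma rel_trace_nondegenerate (x : L) :
  x != 0 -> exists y, rel_trace m (y * x : L) != 0.
Proof.
exact: (ftrace_nondegenerate embD embM emb1 m_gt0 p_prime card_E card_LE).
Qed.

Lemma rel_trace_surjective (x : L) (c : E) :
  x != 0 -> exists y, rel_trace m (y * x : L) = c.
Proof.
case/rel_trace_nondegenerate=> y tr_y; exists ((c / rel_trace m (y * x : L)) *: y).
by rewrite -scalerAl rel_traceZ divfK.
Qed.

(** Transitivity of the trace. Both sides are compared inside [L], where [x ^+ (p ^ (s * i + j))] is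
    the [p ^ j]-th power of the conjugate [x ^+ (#|E| ^ i)]. *)
Lemma abs_trace_rel (x : L) : abs_trace p (s * m) x = abs_trace p s (rel_trace m x).
Proof.
have sm_gt0 : (0 < s * m)%N by rewrite muln_gt0 s_gt0.
apply: (@abs_trace_emb_inj _ p_prime (finvect_type L) _ card_L).
rewrite (@abs_traceE _ p_prime (finvect_type L) _ sm_gt0 card_L).
transitivity (emb (abs_trace p s (rel_trace m x) : nat)%:R); last first.
  by rewrite /emb scaler_nat.
rewrite (abs_traceE p_prime s_gt0 card_E).
have emb0 : emb 0 = 0 by apply: scale0r.
rewrite (big_morph emb embD emb0).
have embX n : {morph emb : x / x ^+ n}.
  by move=> y; elim: n => [|n IH]; rewrite ?expr0 ?emb1 // !exprS embM IH.
have pcharL : p \in [pchar finvect_type L] by exact: (card_finPcharP card_L p_prime).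
have frobD j : {morph (fun y : finvect_type L => y ^+ (p ^ j)) : y z / y + z}.
  move=> y z; rewrite exprDn_pchar // pnatX.
  by rewrite (eq_pnat _ (pcharf_eq pcharL)) pnat_id.
rewrite [LHS](sum_ord_mul _ _ (fun i => (x : finvect_type L) ^+ (p ^ i))).
apply: eq_bigr => j _.
rewrite embX (ftraceE embD embM emb1 m_gt0 p_prime card_E card_LE).
rewrite (big_morph _ (frobD j) (_ : 0 ^+ (p ^ j) = 0)); last first.
  by rewrite expr0n gtn_eqF // expn_gt0 prime_gt0.
by apply: eq_bigr => i _; rewrite -exprM card_E -expnM -expnD.
Qed.

End RelativeTrace.

(** * Additive characters and Fourier inversion *)

Definition psi (p : nat) (c : 'F_p) : algC := zeta p ^+ c.

Section PrimeCharacter.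

Variables (p : nat) (p_prime : prime p).
Local Notation psi := (@psi p).

Lemma psiD (a b : 'F_p) : psi (a + b) = psi a * psi b.
Proof.
have zp1 : zeta p ^+ (Zp_trunc (pdiv p)).+2 = 1.
  by rewrite Fp_cast // (prim_expr_order (zeta_prim p_prime)).
by rewrite /psi /= -exprD expr_mod.
Qed.

Lemma psi0 : psi 0 = 1. Proof. by []. Qed.

Lemma psi_inj : injective psi.
Proof.
move=> a b /eqP; rewrite (eq_prim_root_expr (zeta_prim p_prime)).
have lt_p (c : 'F_p) : (c < p)%N by rewrite -[ltnRHS](Fp_cast p_prime).
by rewrite !modn_small // => /eqP/val_inj.
Qed.

Lemma psi_exp_prime c : psi c ^+ p = 1.
Proof.
by rewrite /psi exprAC (prim_expr_order (zeta_prim p_prime)) expr1n.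
Qed.

Lemma norm_psi c : `|psi c| = 1.
Proof.
apply/eqP; rewrite -(pexpr_eq1 (prime_gt0 p_prime)) // -normrX psi_exp_prime.
by rewrite normr1.
Qed.

(** Raising to the odd power [p] removes the root of unity and keeps the sign, so the sign is
    determined first and the exponent after it. *)
Lemma signed_psi_inj (e1 e2 : int) (c1 c2 : 'F_p) : odd p ->
    e1 = 1 \/ e1 = -1 -> e2 = 1 \/ e2 = -1 ->
  e1%:~R * psi c1 = e2%:~R * psi c2 -> e1 = e2 /\ c1 = c2.
Proof.
move=> p_odd se1 se2 eq12.
have e12 : e1 = e2.
  apply/eqP; rewrite -(eqr_int algC).
  have signX (e : int) : e = 1 \/ e = -1 -> (e%:~R : algC) ^+ p = e%:~R.
    by case=> ->; rewrite ?expr1n // -signr_odd p_odd.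
  have /(congr1 (fun x => x ^+ p)) := eq12.
  by rewrite !exprMn !psi_exp_prime !signX // !mulr1 => ->.
split=> //; apply: psi_inj; move: eq12; rewrite e12; apply: mulfI.
by rewrite intr_eq0; case: se2 => ->.
Qed.

Section AdditiveMap.

Variables (T : finZmodType) (f : T -> 'F_p).
Hypothesis fD : {morph f : x y / x + y}.

Lemma additive_fun0 : f 0 = 0.
Proof. by apply: (addrI (f 0)); rewrite -fD !addr0. Qed.

Lemma additive_funN : {morph f : x / - x}.
Proof.
by move=> x; apply: (addrI (f x)); rewrite -fD !subrr additive_fun0.
Qed.

(** Translation by [x0] multiplies the sum by [psi (f x0)], which is not 1. Invariance of [A] is all
    that is asked, so that subspaces can be summed over as well. *)
Lemma sum_psi_eq0 (A : pred T) x0 : (forall x, A (x0 + x) = A x) ->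
  f x0 != 0 -> \sum_(x | A x) psi (f x) = 0.
Proof.
move=> A_x0 fx0; apply/eqP; set S := \sum_(x | A x) _.
have : S = psi (f x0) * S.
  rewrite {1}/S (reindex_inj (addrI x0)) mulr_sumr.
  by apply: eq_big => [x|x _] //; rewrite fD psiD.
move/eqP; rewrite -{1}[S]mul1r -subr_eq0 -mulrBl mulf_eq0 subr_eq0 => /orP[]//.
by rewrite -psi0 => /eqP/psi_inj f0; rewrite -f0 eqxx in fx0.
Qed.

End AdditiveMap.

Section Fourier.

Variables (T : finZmodType) (B : T -> T -> 'F_p).
Hypotheses (BDl : forall y, {morph B^~ y : x z / x + z}).
Hypotheses (BDr : forall x, {morph B x : y z / y + z}).
Hypothesis B_nondeg : forall y, y != 0 -> exists x, B x y != 0.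

Lemma sum_psi_pairing y :
  \sum_x psi (B x y) = (y == 0)%:R * #|T|%:R :> algC.
Proof.
have [->|/B_nondeg[x Bxy]] := eqVneq y 0; last first.
  by rewrite mul0r (sum_psi_eq0 (BDl y) (A := predT) (x0 := x)).
under eq_bigr do rewrite (additive_fun0 (BDr _)) psi0.
by rewrite sumr_const mul1r.
Qed.

Lemma fourier_inversion (g : T -> algC) y :
  \sum_x psi (- B x y) * (\sum_z g z * psi (B x z)) = #|T|%:R * g y.
Proof.
under eq_bigr do rewrite mulr_sumr.
rewrite exchange_big /= (bigD1 y) //= [X in _ + X]big1 ?addr0 => [|z z_y].
  under eq_bigr do rewrite mulrCA -psiD addNr psi0.
  by rewrite sumr_const mulr1 mulr_natl.
under eq_bigr do rewrite mulrCA -psiD addrC -additive_funN // -BDr.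
by rewrite -mulr_sumr sum_psi_pairing subr_eq0 (negPf z_y) mul0r mulr0.
Qed.

Lemma fourier_inj (g h : T -> algC) :
  (forall x, \sum_z g z * psi (B x z) = \sum_z h z * psi (B x z)) -> g =1 h.
Proof.
move=> eq_gh y; have T_neq0 : (#|T|%:R : algC) != 0.
  by rewrite pnatr_eq0 -lt0n; apply/card_gt0P; exists 0.
apply: (mulfI T_neq0); rewrite -!fourier_inversion.
by under eq_bigr do rewrite eq_gh.
Qed.

End Fourier.

End PrimeCharacter.

Lemma sum_level_sets (X I : finType) (A : pred X) (h : X -> I)
    (a : I -> algC) (g : X -> algC) :
  \sum_i a i * (\sum_(x | A x && (h x == i)) g x)
    = \sum_(x | A x) a (h x) * g x.
Proof.
rewrite [RHS](partition_big h predT) //=; apply: eq_bigr => i _.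
by rewrite mulr_sumr; apply: eq_bigr => x /andP[_ /eqP->].
Qed.

(** * Fourier-reflexive partitions and translation schemes *)

Section TranslationScheme.

Variables (p : nat) (p_prime : prime p) (T : finZmodType).
Variables (pairing : T -> T -> 'F_p) (Omega : {set {set T}}).
Hypotheses (pairingDl : forall y, {morph pairing^~ y : x z / x + z}).
Hypotheses (pairingDr : forall x, {morph pairing x : y z / y + z}).
Hypothesis pairing_nondeg : forall y, y != 0 -> exists x, pairing x y != 0.
Hypothesis Omega_refl : fourier_reflexive pairing Omega.

Let Omega_part : partition Omega [set: T]. Proof. by case: Omega_refl. Qed.

Let B x y := - pairing x y.

Let BDl y : {morph B^~ y : x z / x + z}.
Proof. by move=> x z; rewrite /B pairingDl opprD. Qed.

Let BDr x : {morph B x : y z / y + z}.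
Proof. by move=> y z; rewrite /B pairingDr opprD. Qed.

Let B_nondeg y : y != 0 -> exists x, B x y != 0.
Proof. by case/pairing_nondeg=> x Bxy; exists x; rewrite oppr_eq0. Qed.

Lemma chiE xi (U : {set T}) :
  chi pairing xi U = \sum_x (x \in U)%:R * psi (B xi x).
Proof.
rewrite /chi big_mkcond; apply: eq_bigr => x _.
by case: ifP => _; rewrite ?mul1r ?mul0r.
Qed.

Lemma eq_in_block (U W : {set T}) x : U \in Omega -> W \in Omega -> x \in W ->
  (x \in U) = (U == W).
Proof.
have /and3P[_ tI _] := Omega_part => UO WO xW.
apply/idP/eqP => [xU | -> //].
by rewrite -(def_pblock tI UO xU) (def_pblock tI WO xW).
Qed.

Definition chi_equiv : rel T :=
  fun xi eta => [forall U in Omega, chi pairing xi U == chi pairing eta U].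

Lemma chi_equivP xi eta :
  reflect (forall U, U \in Omega -> chi pairing xi U = chi pairing eta U)
          (chi_equiv xi eta).
Proof. exact: (iffP 'forall_in_eqP). Qed.

Lemma chi_equiv_equivalence : {in [set: T] & &, equivalence_rel chi_equiv}.
Proof.
move=> x y z _ _ _; split; first by apply/chi_equivP.
move=> /chi_equivP xy; apply/chi_equivP/chi_equivP => h U UO.
  by rewrite -xy ?h.
by rewrite xy ?h.
Qed.

(** A representative of the [j]-th dual cell; the default 0 is harmless because equivalence classes
    are nonempty. *)
Let dual_rep (j : 'I_#|dual_partition pairing Omega|) : T :=
  odflt 0 [pick x in enum_val j].

Let dual_repP xi : exists j, forall U, U \in Omega ->
  chi pairing xi U = chi pairing (dual_rep j) U.
Proof.
set D := dual_partition pairing Omega.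
have D_part : partition D [set: T] := equivalence_partitionP chi_equiv_equivalence.
have DT := cover_partition D_part.
have xiD : pblock D xi \in D by rewrite pblock_mem // DT inE.
exists (enum_rank_in xiD (pblock D xi)) => U UO.
rewrite /dual_rep enum_rankK_in //; case: pickP => [y /= y_xi|/(_ xi)]; last first.
  by rewrite mem_pblock DT inE.
move: y_xi; rewrite pblock_equivalence_partition ?inE //.
  by move/chi_equivP; apply.
exact: chi_equiv_equivalence.
Qed.

(* The matrix (chi_C(U)) indexed by dual cells C and cells U is square because
   Omega is Fourier-reflexive, and has independent rows by Fourier inversion;
   hence every function that is constant on the dual cells is the transform of
   a combination of indicators of cells. *)
Lemma chi_combination (g : T -> algC) :
    (forall xi eta, chi_equiv xi eta -> g xi = g eta) ->
  exists v : 'I_#|Omega| -> algC, forall xi,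
    g xi = \sum_i v i * chi pairing xi (enum_val i).
Proof.
move=> g_const; have [_ _ card_dual] := Omega_refl.
pose M : 'M[algC]_(#|Omega|, #|dual_partition pairing Omega|) :=
  \matrix_(i, j) chi pairing (dual_rep j) (enum_val i).
have combE (v : 'rV[algC]_#|Omega|) xi : exists2 j,
    g xi = g (dual_rep j) &
    \sum_(i < #|Omega|) v 0 i * chi pairing xi (enum_val i) = (v *m M) 0 j.
  have [j xi_j] := dual_repP xi; exists j; first exact/g_const/chi_equivP.
  by rewrite !mxE; apply: eq_bigr => i _; rewrite mxE xi_j ?enum_valP.
(* A row vector killed by [M] gives a combination of cell indicators with zero transform. The
   combination is therefore zero, and at a point of the [i]-th cell it equals [v 0 i]. *)
have M_free : row_free M.
  apply: inj_row_free => v vM; apply/rowP=> i; rewrite mxE.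
  have /and3P[_ _ O_n0] := Omega_part.
  have /set0Pn[x xi] : enum_val i != set0.
    by apply: contraNneq O_n0 => <-; apply: enum_valP.
  have /(_ x) : (fun x => \sum_(j < #|Omega|) v 0 j * (x \in enum_val j)%:R) =1 fun=> 0.
    apply: (@fourier_inj p p_prime T B BDl BDr B_nondeg) => eta.
    rewrite [RHS]big1 => [|y _]; last by rewrite mul0r.
    have [j _] := combE v eta; rewrite vM mxE; apply: etrans.
    under eq_bigr do rewrite mulr_suml.
    rewrite exchange_big; apply: eq_bigr => k _; rewrite chiE mulr_sumr.
    by apply: eq_bigr => y _; rewrite mulrA.
  rewrite (bigD1 i) //= xi mulr1 big1 ?addr0 // => j j_i.
  rewrite (eq_in_block (enum_valP j) (enum_valP i) xi).
  by rewrite (inj_eq enum_val_inj) (negPf j_i) mulr0.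
have M_full : row_full M.
  by move: M_free => /eqP rM; rewrite /row_full rM card_dual.
pose w := \row_j g (dual_rep j).
exists ((w *m pinvmx M) 0) => xi.
have [j -> ->] := combE (w *m pinvmx M) xi.
by rewrite mulmxKpV ?submx_full // mxE.
Qed.

Definition convolution (U1 U2 : {set T}) x :=
  #|[set z | (z \in U1) && (x - z \in U2)]|.

Lemma convolutionC U1 U2 : convolution U1 U2 =1 convolution U2 U1.
Proof.
move=> x; rewrite /convolution -(card_imset _ (inv_inj (subKr x))).
apply: eq_card => z; rewrite inE; apply/imsetP/andP => [[y]|[z1 z2]].
  by rewrite inE => /andP[y1 y2] ->; rewrite subKr.
by exists (x - z); rewrite ?subKr // inE subKr z1 z2.
Qed.

(** The convolution theorem for indicator functions, by the substitution [x := z + x]. *)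
Lemma chi_convolution U1 U2 xi :
  \sum_x (convolution U1 U2 x)%:R * psi (B xi x)
    = chi pairing xi U1 * chi pairing xi U2.
Proof.
have convE x : (convolution U1 U2 x)%:R
    = \sum_z (z \in U1)%:R * (x - z \in U2)%:R :> algC.
  rewrite /convolution -sum1_card natr_sum big_mkcond; apply: eq_bigr => z _.
  by rewrite inE -natrM mulnb; case: (_ && _).
rewrite !chiE mulr_suml.
under eq_bigr do rewrite convE mulr_suml.
rewrite exchange_big /=; apply: eq_bigr => z _.
rewrite (reindex_inj (addrI z)) mulr_sumr /=; apply: eq_bigr => x _.
by rewrite [z + x - z]addrAC subrr add0r BDr psiD // mulrACA.
Qed.

(** A product of two cell characters is constant on dual cells, hence is a combination of cell
    characters; Fourier injectivity makes the convolution the same combination of cell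
    indicators. *)
Lemma convolution_const U1 U2 W x y : U1 \in Omega -> U2 \in Omega ->
  W \in Omega -> x \in W -> y \in W -> convolution U1 U2 x = convolution U1 U2 y.
Proof.
move=> U1O U2O WO xW yW; apply/eqP; rewrite -(eqr_nat algC).
have [v vE] := @chi_combination (fun xi => chi pairing xi U1 * chi pairing xi U2)
  (fun xi eta => ltac:(by move/chi_equivP=> e; rewrite !e)).
have convE : (fun x => (convolution U1 U2 x)%:R)
    =1 fun x => \sum_i v i * (x \in enum_val i)%:R.
  apply: (@fourier_inj p p_prime T B BDl BDr B_nondeg) => xi.
  rewrite chi_convolution vE; under [RHS]eq_bigr do rewrite mulr_suml.
  rewrite exchange_big; apply: eq_bigr => i _; rewrite chiE mulr_sumr.
  by apply: eq_bigr => z _; rewrite mulrA.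
rewrite !convE; apply/eqP/eq_bigr => i _.
by rewrite !(eq_in_block (enum_valP i) WO).
Qed.

Lemma difference_rel_inj : injective (@difference_rel T).
Proof.
move=> U W eUW; apply/setP=> x; have /setP/(_ (0, x)) := eUW.
by rewrite !inE /= subr0.
Qed.

Lemma path_count_difference U1 U2 (u : T * T) :
  path_count (difference_rel U1) (difference_rel U2) u
    = convolution U1 U2 (u.2 - u.1).
Proof.
rewrite /path_count /convolution -[RHS](card_imset _ (addIr u.1)).
apply: eq_card => z; rewrite !inE /=; apply/andP/imsetP => [[z1 z2]|[y]].
  exists (z - u.1); rewrite ?subrK // inE z1.
  by rewrite opprB addrA subrK.
by rewrite inE => /andP[y1 y2] ->; rewrite addrK y1 opprD addrA addrAC.
Qed.

(** The path counts of difference relations are convolutions evaluated at [u.2 - u.1], so constancy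
    on cells gives the intersection numbers and commutativity of convolution the last axiom. *)
Theorem fourier_reflexive_scheme :
    (forall U x, U \in Omega -> x \in U -> - x \in U) ->
  symmetric_association_scheme (#|Omega| - 1) (induced_relations Omega).
Proof.
move=> Omega_sym; have [_ O0 _] := Omega_refl.
have /and3P[/eqP covT _ O_n0] := Omega_part.
have sym R : R \in induced_relations Omega -> transpose_rel R = R.
  case/imsetP=> U UO ->; apply/setP=> -[x y]; rewrite !inE /=.
  by apply/idP/idP => /(Omega_sym _ _ UO); rewrite opprB.
split=> //; split; last 1 first.
- move=> _ _ u /imsetP[U1 U1O ->] /imsetP[U2 U2O ->].
  by rewrite !path_count_difference convolutionC.
- split; last first.
    rewrite card_imset; last exact: difference_rel_inj.
    by rewrite subn1 prednK //; apply/card_gt0P; exists [set 0].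
  apply/and3P; split.
  + apply/eqP/setP=> -[x y]; rewrite in_setT; apply/bigcupP.
    have : y - x \in cover Omega by rewrite covT inE.
    case/bigcupP=> U UO xyU; exists (difference_rel U); first exact: imset_f.
    by rewrite inE.
  + apply/trivIsetP=> _ _ /imsetP[U UO ->] /imsetP[W WO ->] neqUW.
    rewrite -setI_eq0; apply/eqP/setP=> -[x y]; rewrite !inE /=; apply/andP=> -[xU xW].
    move: neqUW; rewrite (inj_eq difference_rel_inj).
    by rewrite -(eq_in_block UO WO xW) xU.
  + apply/imsetP=> -[U UO /setP e0]; move: O_n0; rewrite (_ : set0 = U) ?UO //.
    by apply/setP=> x; have := e0 (0, x); rewrite !inE /= subr0.
- apply/imsetP; exists [set 0] => //; apply/setP=> -[x y]; rewrite !inE /=.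
  by rewrite subr_eq0 eq_sym.
- by move=> R RO; rewrite sym.
move=> _ _ _ u v /imsetP[U1 U1O ->] /imsetP[U2 U2O ->] /imsetP[W WO ->].
rewrite !inE !path_count_difference; exact: convolution_const.
Qed.

End TranslationScheme.

Lemma sum_nonzero_unit (R : nmodType) (F : finFieldType) (f : F -> R) :
  \sum_(t | t != 0) f t = \sum_(t : {unit F}) f (val t).
Proof.
rewrite (reindex_onto val (insubd (1%g : {unit F}))) /=; last first.
  by move=> t; rewrite -unitfE => tU; rewrite insubdK.
apply: eq_bigl => t; rewrite valKd eqxx andbT -unitfE.
exact: valP.
Qed.

(** * Values of functions with prescribed character sums *)

Section NonzeroValues.

Variables (p s N : nat) (p_prime : prime p) (s_gt0 : (0 < s)%N).
Variables (F : finFieldType) (card_F : #|F| = (p ^ s)%N).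
Variables (X : finZmodType) (Q : X -> F) (sgn : {unit F} -> int).
Hypotheses (card_X : #|X| = (N * N)%N) (F_le_N : (#|F| <= N)%N) (Q0 : Q 0 = 0).
Hypothesis sgnP : forall t, sgn t = 1 \/ sgn t = -1.
Hypothesis sum_Q : forall t : {unit F},
  \sum_x psi (abs_trace p s (val t * Q x : F)) = (sgn t)%:~R * N%:R.

Let fibre i := #|[set x | Q x == i]|.
Let S i : algC := \sum_(t : {unit F}) (sgn t)%:~R * psi (- abs_trace p s (val t * i : F)).

Let F_gt0 : (0 < #|F|)%N. Proof. by rewrite ltnW ?finNzRing_gt1. Qed.
Let N_gt0 : (0 < N)%N. Proof. exact: leq_trans F_le_N. Qed.

(** Fourier inversion over [F] applied to the fibre sizes: frequency 0 contributes [#|X| = N * N],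
    the others the prescribed sums. *)
Lemma card_fibreE i : (#|F| * fibre i)%:R = N%:R * (N%:R + S i) :> algC.
Proof.
pose B (t j : F) := abs_trace p s (t * j : F).
have BDl j : {morph B^~ j : t u / t + u}.
  by move=> t u; rewrite /B mulrDl (abs_traceD p_prime s_gt0 card_F).
have BDr t : {morph B t : t u / t + u}.
  by move=> j l; rewrite /B mulrDr (abs_traceD p_prime s_gt0 card_F).
have B_nondeg j : j != 0 -> exists t, B t j != 0.
  exact: (abs_trace_nondegenerate p_prime s_gt0 card_F).
rewrite natrM -(fourier_inversion p_prime BDl BDr B_nondeg (fun j => (fibre j)%:R)).
have hat t : \sum_j (fibre j)%:R * psi (B t j) = \sum_x psi (B t (Q x)).
  rewrite [RHS](partition_big Q predT) //=; apply: eq_bigr => j _.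
  rewrite /fibre -sum1_card natr_sum mulr_suml big_mkcond [RHS]big_mkcond.
  by apply: eq_bigr => x _; rewrite inE; case: eqP => [->|//]; rewrite mul1r.
under eq_bigr do rewrite hat.
rewrite (bigD1 0) //= sum_nonzero_unit mulrDr /S [in RHS]mulr_sumr; congr (_ + _).
  have B0 j : B 0 j = 0 := additive_fun0 (BDl j).
  under eq_bigr do rewrite B0 psi0.
  rewrite B0 oppr0 psi0 mul1r.
  by rewrite sumr_const card_X natrM.
by apply: eq_bigr => t _; rewrite sum_Q mulrC -mulrA mulrCA.
Qed.

Let card_unit : #|{: {unit F}}| = #|F|.-1.
Proof. by rewrite -card_finField_unit cardsT. Qed.

(** An empty fibre would force [S i = - N], whereas [S i] is a sum of [#|F| - 1 < N] numbers of
    modulus 1. *)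
Lemma fibre_gt0 i : (0 < fibre i)%N.
Proof.
rewrite lt0n; apply/eqP=> fib0; have /eqP := card_fibreE i.
rewrite fib0 muln0 eq_sym mulf_eq0 pnatr_eq0 gtn_eqF //= addrC addr_eq0.
move/eqP/(congr1 Num.norm); rewrite normrN normr_nat => S_N.
have : N%:R <= (#|F|.-1)%:R :> algC.
  rewrite -S_N (le_trans (ler_norm_sum _ _ _)) //.
  under eq_bigr do rewrite normrM (norm_psi p_prime) mulr1.
  rewrite (eq_bigr (fun=> 1)) ?sumr_const ?card_unit // => t _.
  by case: (sgnP t) => ->; rewrite ?normrN normr1.
by rewrite ler_nat leqNgt prednK // F_le_N.
Qed.

(** With [T] the sum of the nonnegative integers [sgn t + 1], inversion at 0 reads
    [#|F| * fibre 0 = N * (N - #|F| + 1 + T)]. As [N >= #|F|], the second factor is at least 1, so a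
    singleton fibre forces [N = #|F|] and [T = 0]. *)
Lemma fibre0_eq1 : (fibre 0 == 1) = (N == #|F|) && [forall t, sgn t == -1].
Proof.
have S0 : S 0 = (\sum_t sgn t)%:~R.
  rewrite rmorph_sum; apply: eq_bigr => t _.
  by rewrite mulr0 (additive_fun0 (abs_traceD p_prime s_gt0 card_F)) oppr0 mulr1.
have fibE : (#|F| * fibre 0)%:Z = N%:Z * (N%:Z + \sum_t sgn t).
  by apply/eqP; rewrite -(eqr_int algC) intrM intrD -S0 -card_fibreE.
have sgn1 : \sum_t sgn t = \sum_t (sgn t + 1) - (#|F|.-1)%:Z.
  by rewrite big_split sumr_const card_unit natz addrK.
have sgn_ge0 t : true -> 0 <= sgn t + 1 by case: (sgnP t) => ->.
have tot_ge0 : 0 <= \sum_t (sgn t + 1) by exact: sumr_ge0.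
have predF : (#|F|.-1)%:Z = #|F|%:Z - 1 by rewrite -subn1 subzn.
have NF : #|F|%:Z <= N%:Z by [].
have F_pos : 1 <= #|F|%:Z by [].
apply/eqP/andP => [fib1 | [/eqP eqN /forallP sgnN]].
  move: fibE; rewrite fib1 muln1 sgn1 predF => fibE.
  have eqN : N%:Z = #|F|%:Z by nia.
  have /eqP : \sum_t (sgn t + 1) = 0 by nia.
  rewrite psumr_eq0 // => /allP sgnN; split; first by apply/eqP; lia.
  by apply/forallP=> t; have := sgnN t (mem_index_enum _); rewrite addr_eq0.
move: fibE; rewrite sgn1 big1 => [|t _]; last by rewrite (eqP (sgnN t)).
rewrite predF -eqN => fibE; suff : (fibre 0)%:Z = 1 by lia.
have N_pos : 1 <= N%:Z by [].
nia.
Qed.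

(** All fibres are nonempty and [Q 0 = 0], so discarding the argument 0 can lose only the value 0,
    and does so exactly when the fibre of 0 is a singleton. This is the source of [delta]. *)
Lemma card_nonzero_values :
  #|[set i | [exists x, (x != 0) && (Q x == i)]]|
    = if (N == #|F|) && [forall t, sgn t == -1] then #|F|.-1 else #|F|.
Proof.
have nz i : [exists x, (x != 0) && (Q x == i)] = (i != 0) || (fibre 0 != 1%N).
  have [->|i_neq0] /= := eqVneq i 0.
    rewrite /fibre (cardsD1 0) inE Q0 eqxx add1n eqSS cards_eq0.
    apply/existsP/set0Pn => -[x xP]; exists x; last by move: xP; rewrite !inE.
    by rewrite !inE.
  have /card_gt0P[x] := fibre_gt0 i; rewrite inE => Qx.
  apply/existsP; exists x; rewrite Qx andbT; apply: contraNneq i_neq0 => x0.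
  by rewrite -(eqP Qx) x0 Q0.
rewrite -fibre0_eq1; case: ifP => fib1.
  rewrite -(cardsC1 0); apply: eq_card => i; rewrite !inE nz fib1 orbF.
  by [].
by rewrite -cardsT; apply: eq_card => i; rewrite !inE nz fib1 orbT.
Qed.

End NonzeroValues.

(** * Cells as level sets *)

Section LevelPartition.

Variables (X L : finType) (f : X -> L).

Lemma preim_partitionE :
  preim_partition f [set: X] = [set f @^-1: [set l] | l : L] :\ set0.
Proof.
have cellE x : [set y in [set: X] | f x == f y] = f @^-1: [set f x].
  by apply/setP=> y; rewrite !inE eq_sym.
apply/setP=> U; rewrite !inE; apply/imsetP/andP => [[x _ ->]|[U0 /imsetP[l _ Ul]]].
  rewrite cellE imset_f ?inE //; split=> //.
  by apply/set0Pn; exists x; rewrite !inE.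
move: U0; rewrite Ul => /set0Pn[x]; rewrite !inE => /eqP <-.
by exists x; rewrite ?inE ?cellE.
Qed.

Lemma card_preim_partition :
  #|preim_partition f [set: X]| = #|[set l | [exists x, f x == l]]|.
Proof.
rewrite preim_partitionE.
rewrite -(card_in_imset (f := fun l => f @^-1: [set l])) => [|l l']; last first.
  rewrite !inE => /existsP[x /eqP <-] _ /setP/(_ x).
  by rewrite !inE eqxx => /esym/eqP.
apply: eq_card => U; rewrite !inE; apply/andP/imsetP => [[U0 /imsetP[l _ Ul]]|[l]].
  exists l => //; rewrite inE; move: U0; rewrite Ul => /set0Pn[x].
  by rewrite !inE => fx; apply/existsP; exists x.
rewrite inE => /existsP[x fx] ->; split; last exact: imset_f.
by apply/set0Pn; exists x; rewrite !inE.
Qed.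

End LevelPartition.

Lemma card_sum_pred (A B : finType) (S : pred (A + B)) :
  #|S| = (#|[pred x | S (inl x)]| + #|[pred x | S (inr x)]|)%N.
Proof. by rewrite -!sum1_card big_sumType. Qed.

Lemma card_const_pred (T : finType) (b : bool) : #|[pred _ : T | b]| = (b * #|T|)%N.
Proof. by case: b; rewrite ?mul1n ?mul0n; [apply: eq_card | apply: eq_card0]. Qed.

Section Cells.

Variables (Fr : finFieldType) (Fq : fieldExtType Fr) (vT : finZmodType).
Variables (K0 : {vspace Fq}) (W : {set finvect_type Fq}).
Local Notation qT := (finvect_type Fq).

(** The summands stand, from left to right, for the cells c_i, d_i, e_i, B_2, B_1 and the origin.
    Coordinates and values are separate arguments, so that both partitions, with their last two
    coordinates exchanged, are instances. *)
Definition cell_label (x : vT) (y z : qT) (h g : Fr) :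
    (Fr + (Fr + (Fr + (unit + (unit + unit)))))%type :=
  if z \notin K0 then inl h else
  if z != 0 then inr (inl h) else
  if x != 0 then inr (inr (inl g)) else
  if y \notin W then inr (inr (inr (inl tt))) else
  if y != 0 then inr (inr (inr (inr (inl tt))))
  else inr (inr (inr (inr (inr tt)))).

(** Equality of labels is unfolded into a cascade of conditions, in the order in which the
    characters of the cells detect them. *)
Lemma cell_label_eqP x y z h g x' y' z' h' g' : 0 \in W ->
  cell_label x y z h g = cell_label x' y' z' h' g' <->
  [/\ (z \in K0) = (z' \in K0), (z == 0) = (z' == 0), z != 0 -> h = h' &
      z = 0 -> [/\ (x == 0) = (x' == 0), x != 0 -> g = g' &
                   x = 0 -> (y \in W) = (y' \in W) /\ (y == 0) = (y' == 0)]].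
Proof.
move=> W0; rewrite /cell_label.
have [->|z0] := eqVneq z 0; have [->|z0'] := eqVneq z' 0; rewrite ?mem0v /=.
- have [->|x0] := eqVneq x 0; have [_|x0'] := eqVneq x' 0; rewrite /=.
  + have [->|y0] := eqVneq y 0; have [->|y0'] := eqVneq y' 0; rewrite ?W0 /=.
    * by split.
    * by case: (y' \in W); split=> //= -[_ _ _ /(_ erefl)[_ _ /(_ erefl)[]]].
    * by case: (y \in W); split=> //= -[_ _ _ /(_ erefl)[_ _ /(_ erefl)[]]].
    by case: (y \in W); case: (y' \in W); split=> //= -[_ _ _ /(_ erefl)[_ _ /(_ erefl)[]]].
  + by do ?case: ifP => _; split=> //= -[_ _ _ /(_ erefl)[]].
  + by do ?case: ifP => _; split=> //= -[_ _ _ /(_ erefl)[]].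
  split=> [[->]|[_ _ _ /(_ erefl)[_ /(_ isT)-> _]]] //; split=> // _; split=> //.
  by move/eqP; rewrite (negPf x0).
- by split=> [|[]//]; do ?case: ifP => _.
- by split=> [|[]//]; do ?case: ifP => _.
have z0E : z = 0 -> False by move/eqP; rewrite (negPf z0).
case: (z \in K0); case: (z' \in K0); split=> //=.
- by case=> ->; split=> // /z0E.
- by case=> _ _ /(_ isT)->.
- by case.
- by case.
- by case=> ->; split=> // /z0E.
by case=> _ _ /(_ isT)->.
Qed.

Variables (Y : finType) (x : Y -> vT) (y z : Y -> qT) (h g : Y -> Fr).
Hypothesis W0 : 0 \in W.

Let f a := cell_label (x a) (y a) (z a) (h a) (g a).

Definition cells : {set {set Y}} :=
  ([set [set a | [&& x a == 0, y a == 0 & z a == 0]];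
        [set a | [&& x a == 0, z a == 0, y a \in W & y a != 0]];
        [set a | [&& x a == 0, z a == 0 & y a \notin W]]]
    :|: [set [set a | [&& z a == 0, x a != 0 & g a == i]] | i : Fr]
    :|: [set [set a | [&& z a \in K0, z a != 0 & h a == i]] | i : Fr]
    :|: [set [set a | (z a \notin K0) && (h a == i)] | i : Fr]) :\ set0.

Lemma preim_cell_label l : f @^-1: [set l] = match l with
  | inl i => [set a | (z a \notin K0) && (h a == i)]
  | inr (inl i) => [set a | [&& z a \in K0, z a != 0 & h a == i]]
  | inr (inr (inl i)) => [set a | [&& z a == 0, x a != 0 & g a == i]]
  | inr (inr (inr (inl _))) => [set a | [&& x a == 0, z a == 0 & y a \notin W]]
  | inr (inr (inr (inr (inl _)))) => [set a | [&& x a == 0, z a == 0, y a \in W & y a != 0]]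
  | inr (inr (inr (inr (inr _)))) => [set a | [&& x a == 0, y a == 0 & z a == 0]]
  end.
Proof.
case: l => [i|[i|[i|[[]|[[]|[]]]]]]; apply/setP=> a; rewrite !inE /f /cell_label;
  have [za|za] := boolP (z a \in K0); rewrite ?andbF //=;
  have [z0|z0] := eqVneq (z a) 0; rewrite ?andbF //=;
  try (by move: za; rewrite z0 mem0v);
  have [x0|x0] := eqVneq (x a) 0; rewrite ?andbF //=;
  have [yW|yW] := boolP (y a \in W); rewrite ?andbF //=;
  have [y0|y0] := eqVneq (y a) 0; rewrite ?andbF //=;
  by move: yW; rewrite y0 W0.
Qed.

Lemma cellsE : cells = preim_partition f [set: Y].
Proof.
rewrite preim_partitionE /cells; congr (_ :\ _); apply/setP=> U.
rewrite !inE; apply/idP/imsetP => [|[l _ ->]].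
  case/orP=> [/orP[/orP[/orP[/orP[/eqP->|/eqP->]|/eqP->]|/imsetP[i _ ->]]
                  |/imsetP[i _ ->]]|/imsetP[i _ ->]].
  - by exists (inr (inr (inr (inr (inr tt))))); rewrite ?preim_cell_label.
  - by exists (inr (inr (inr (inr (inl tt))))); rewrite ?preim_cell_label.
  - by exists (inr (inr (inr (inl tt)))); rewrite ?preim_cell_label.
  - by exists (inr (inr (inl i))); rewrite ?preim_cell_label.
  - by exists (inr (inl i)); rewrite ?preim_cell_label.
  by exists (inl i); rewrite ?preim_cell_label.
rewrite preim_cell_label; case: l => [i|[i|[i|[[]|[[]|[]]]]]]; rewrite ?eqxx ?orbT //.
- by rewrite [X in _ || X]imset_f ?orbT.
- by rewrite [X in (_ || X) || _]imset_f ?orbT.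
by rewrite [X in (_ || X) || _ || _]imset_f ?orbT.
Qed.

Variables (mk : vT -> qT -> qT -> Y) (Q : vT -> Fr).
Hypotheses (x_mk : forall u v w, x (mk u v w) = u).
Hypotheses (y_mk : forall u v w, y (mk u v w) = v).
Hypotheses (z_mk : forall u v w, z (mk u v w) = w).
Hypothesis h_surj : forall u w i, w != 0 -> exists v, h (mk u v w) = i.
Hypothesis gQ : forall a, z a = 0 -> g a = Q (x a).
Variables b b' : bool.
Hypotheses (K1_ex : [exists w : qT, w \notin K0] = b).
Hypotheses (K0_ex : [exists w : qT, (w \in K0) && (w != 0)] = b').
Hypotheses (W_ex : [exists v, (v \in W) && (v != 0)] = b).
Hypotheses (WC_ex : [exists v, v \notin W] = b').

(** The summands count the nonempty cells of type c, d, e, B_2, B_1 and the origin, in this order.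
    Surjectivity of [h] over each nonzero [w] makes a whole family c or d nonempty as soon as its
    region is. *)
Lemma card_cells :
  #|cells| = (b * #|Fr| + (b' * #|Fr|
    + (#|[set i : Fr | [exists u : vT, (u != 0%R) && (Q u == i)]]|
    + (b' + (b + 1)))))%N.
Proof.
rewrite cellsE card_preim_partition.
have hit l : [exists a, f a == l] = (f @^-1: [set l] != set0).
  apply/existsP/set0Pn => -[a fa]; exists a; first by rewrite !inE.
  by rewrite !inE in fa.
rewrite (eq_card (B := [pred l | f @^-1: [set l] != set0])) => [|l]; last first.
  by rewrite !inE hit.
rewrite !card_sum_pred; congr (_ + (_ + (_ + (_ + (_ + _)))))%N.
- rewrite -card_const_pred; apply: eq_card => i; rewrite !inE preim_cell_label -K1_ex.
  apply/set0Pn/existsP => [[a]|[w wK]]; first by rewrite inE => /andP[zK _]; exists (z a).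
  have [|v hv] := h_surj 0 i (_ : w != 0); first by apply: contraNneq wK => ->; apply: mem0v.
  by exists (mk 0 v w); rewrite inE z_mk wK hv eqxx.
- rewrite -card_const_pred; apply: eq_card => i; rewrite !inE preim_cell_label -K0_ex.
  apply/set0Pn/existsP => [[a]|[w /andP[wK w0]]].
    by rewrite inE => /and3P[zK z0 _]; exists (z a); rewrite zK.
  have [v hv] := h_surj 0 i w0.
  by exists (mk 0 v w); rewrite inE z_mk wK w0 hv eqxx.
- apply: eq_card => i; rewrite !inE preim_cell_label.
  apply/set0Pn/existsP => [[a]|[u /andP[u0 Qu]]].
    by rewrite inE => /and3P[/eqP z0 x0 ga]; exists (x a); rewrite x0 -gQ.
  by exists (mk u 0 0); rewrite inE z_mk x_mk eqxx u0 gQ ?z_mk // x_mk.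
- rewrite -[RHS]muln1 -card_unit -card_const_pred; apply: eq_card => i.
  rewrite !inE preim_cell_label -WC_ex; apply/set0Pn/existsP => [[a]|[v vW]].
    by rewrite inE => /and3P[_ _ yW]; exists (y a).
  by exists (mk 0 v 0); rewrite inE x_mk y_mk z_mk !eqxx.
- rewrite -[RHS]muln1 -card_unit -card_const_pred; apply: eq_card => i.
  rewrite !inE preim_cell_label -W_ex; apply/set0Pn/existsP => [[a]|[v /andP[vW v0]]].
    by rewrite inE => /and4P[_ _ yW y0]; exists (y a); rewrite yW.
  by exists (mk 0 v 0); rewrite inE x_mk y_mk z_mk !eqxx vW.
rewrite -[RHS]card_unit; apply: eq_card => i; rewrite !inE preim_cell_label.
by apply/set0Pn; exists (mk 0 0 0); rewrite inE x_mk y_mk z_mk !eqxx.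
Qed.

End Cells.

(** * Bent functions and the transforms of the cells *)

Section BentDuals.

Variables (p : nat) (p_prime : prime p) (p_odd : odd p).
Variables (V : vectType 'F_p) (form : {symmetric V}).
Local Notation vT := (finvect_type V).

Lemma bent_abs_neq0 : bent_abs V != 0.
Proof. by rewrite pnatr_eq0 -lt0n expn_gt0 prime_gt0. Qed.

(** Weak regularity provides some dual with constant sign; since sign and exponent are determined by
    the Walsh value, it agrees with the given dual [g]. *)
Lemma weakly_regular_dual (f g : vT -> 'F_p) e :
    weakly_regular form f e -> is_dual form f g ->
  (e = 1 \/ e = -1) /\
  forall b, walsh form f b = e%:~R * bent_abs V * psi (g b).
Proof.
case=> _ [fs f_fs] [eps f_g]; have [e1 _] := f_fs 0.
split=> // b; have [_ walsh_fs] := f_fs b; have [eb walsh_g] := f_g b.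
suff [eeps fg] : e = eps b /\ fs b = g b by rewrite walsh_fs fg.
apply: (signed_psi_inj p_prime p_odd) => //; apply: (mulfI bent_abs_neq0).
by rewrite !mulrA ![bent_abs V * _]mulrC -walsh_g.
Qed.

(** Nondegeneracy is stated as vanishing of the radical; a vector orthogonal to every [u] lies
    there, symmetry exchanging the two arguments. *)
Lemma form_nondegP : nondegenerate form ->
  forall x : vT, x != 0 -> exists u : vT, form u x != 0.
Proof.
move=> /eqP nondeg x x_neq0.
have [/existsP//|] := boolP [exists u : vT, form u x != 0].
rewrite negb_exists => /forallP x_orth; case/negP: x_neq0.
suff : (x : V) \in (0%VS : {vspace V}) by rewrite memv0.
rewrite -nondeg; apply/mem_orthovP => u _; apply/eqP; rewrite herm_eq0C.
by have := x_orth u; rewrite negbK.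
Qed.

End BentDuals.

(** As a function of [t], the weighted sum is the Fourier transform over [F] of the characters of
    the level sets as a function of [i], and this transform is injective. *)
Lemma level_chiP (p s : nat) (p_prime : prime p) (s_gt0 : (0 < s)%N)
    (F : finFieldType) (card_F : #|F| = (p ^ s)%N) (T : finZmodType)
    (pairing : T -> T -> 'F_p) (A : pred T) (h : T -> F) xi eta :
  (forall i, chi pairing xi [set a | A a && (h a == i)]
           = chi pairing eta [set a | A a && (h a == i)]) <->
  (forall t : F,
    \sum_(a | A a) psi (abs_trace p s (t * h a : F)) * psi (- pairing xi a)
    = \sum_(a | A a) psi (abs_trace p s (t * h a : F)) * psi (- pairing eta a)).
Proof.
have chiE' th i : chi pairing th [set a | A a && (h a == i)]
    = \sum_(a | A a && (h a == i)) psi (- pairing th a).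
  by apply: eq_bigl => a; rewrite inE.
have hat th (t : F) :
    \sum_(a | A a) psi (abs_trace p s (t * h a : F)) * psi (- pairing th a)
    = \sum_i chi pairing th [set a | A a && (h a == i)] * psi (abs_trace p s (t * i : F)).
  rewrite -(sum_level_sets A h (fun i => psi (abs_trace p s (t * i : F)))).
  by apply: eq_bigr => i _; rewrite chiE' mulrC.
split=> [eq_chi t|eq_hat].
  by rewrite !hat; apply: eq_bigr => i _; rewrite eq_chi.
have trD := abs_traceD p_prime s_gt0 card_F.
apply: (@fourier_inj p p_prime F (fun t i => abs_trace p s (t * i : F))).
- by move=> y x z; rewrite mulrDl trD.
- by move=> y x z; rewrite mulrDr trD.
- exact: (abs_trace_nondegenerate p_prime s_gt0 card_F).
by move=> t; rewrite -!hat.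
Qed.

(** * Orthogonality relations on the ambient space, its factors, [K0] and its orthogonal *)

Section VectorialBent.

Variables (p k s : nat) (Fr : finFieldType) (Fq : fieldExtType Fr).
Variables (V : vectType 'F_p) (form : {symmetric V}) (K0 : {vspace Fq}).
Hypotheses (p_prime : prime p) (s_gt0 : (0 < s)%N) (k_gt0 : (0 < k)%N).
Hypotheses (s_dvd_k : (s %| k)%N) (card_Fr : #|Fr| = (p ^ s)%N).
Hypothesis card_Fq : #|finvect_type Fq| = (p ^ k)%N.
Hypothesis form_nondegenerate : nondegenerate form.
Local Notation vT := (finvect_type V).
Local Notation qT := (finvect_type Fq).
Local Notation trs x := (abs_trace p s (x : Fr)).
Local Notation trk x := (abs_trace p k (x : Fq)).
Local Notation Tr x := (rel_trace (k %/ s) (x : Fq)).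
Local Notation pairing := (ambient_form k (Fq := Fq) form).
Local Notation q := (#|qT|%:R : algC).

Let k_eq : k = (s * (k %/ s))%N. Proof. by rewrite mulnC divnK. Qed.
Let m_gt0 : (0 < k %/ s)%N. Proof. by rewrite divn_gt0 // dvdn_leq. Qed.
Let card_Fq' : #|finvect_type Fq| = (p ^ (s * (k %/ s)))%N.
Proof. by rewrite -k_eq. Qed.

Lemma trsD : {morph @abs_trace p Fr s : x y / x + y}.
Proof. exact: (abs_traceD p_prime s_gt0 card_Fr). Qed.

Lemma trkD : {morph @abs_trace p Fq k : x y / x + y}.
Proof. exact: (abs_traceD p_prime k_gt0 card_Fq). Qed.

Lemma trk_nondeg (x : qT) : x != 0 -> exists y : qT, trk (y * x) != 0.
Proof. exact: (abs_trace_nondegenerate p_prime k_gt0 card_Fq). Qed.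

Lemma trk_rel (x : Fq) : trk x = trs (Tr x).
Proof.
by rewrite -(abs_trace_rel p_prime s_gt0 m_gt0 card_Fr card_Fq') -k_eq.
Qed.

Lemma TrZ c x : Tr (c *: x) = c * Tr x.
Proof. exact: (rel_traceZ p_prime m_gt0 card_Fr card_Fq'). Qed.

Let trkN : {morph @abs_trace p Fq k : x / - x}.
Proof. exact: (@additive_funN p qT _ trkD). Qed.

Let trk0 : trk 0 = 0.
Proof. exact: (@additive_fun0 p qT _ trkD). Qed.

Let trsN : {morph @abs_trace p Fr s : x / - x}.
Proof. exact: (@additive_funN p Fr _ trsD). Qed.

Lemma pairingDl y : {morph pairing^~ y : x z / x + z}.
Proof.
case: y => -[y1 y2] y3 [[x1 x2] x3] [[z1 z2] z3] /=.
by rewrite linearDl !mulrDl !trkD; ring.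
Qed.

Lemma pairingDr x : {morph pairing x : y z / y + z}.
Proof.
case: x => -[x1 x2] x3 [[y1 y2] y3] [[z1 z2] z3] /=.
by rewrite linearDr !mulrDr !trkD; ring.
Qed.

Lemma pairing_nondeg y : y != 0 -> exists x, pairing x y != 0.
Proof.
case: y => -[y1 y2] y3.
have [y1_0|y1_neq0] := eqVneq y1 0; last first.
  have [u uy] := form_nondegP form_nondegenerate y1_neq0.
  by exists (u, 0, 0); rewrite /= !mul0r trk0 !addr0.
have [y2_0|y2_neq0] := eqVneq y2 0; last first.
  have [u uy] := trk_nondeg y2_neq0.
  by exists (0, u, 0); rewrite /= !mul0r linear0l trk0 add0r addr0.
have [y3_0|y3_neq0] := eqVneq y3 0; last first.
  have [u uy] := trk_nondeg y3_neq0.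
  by exists (0, 0, u); rewrite /= !mul0r linear0l trk0 !add0r.
by rewrite y1_0 y2_0 y3_0 eqxx.
Qed.

Lemma sum_ambient (A : pred qT) (F : ambient Fq V -> algC) :
  \sum_(a | A a.2) F a = \sum_(z | A z) \sum_x \sum_y F (x, y, z).
Proof.
under [RHS]eq_bigr do rewrite pair_bigA /=.
rewrite exchange_big pair_big /=.
by apply: eq_bigr => -[[x y] z].
Qed.

Lemma sum_trk (y : qT) : \sum_(x : qT) psi (trk (x * y)) = (y == 0)%:R * q.
Proof.
apply: (@sum_psi_pairing p p_prime qT (fun x y => trk (x * y))).
- by move=> z x t; rewrite mulrDl trkD.
- by move=> z x t; rewrite mulrDr trkD.
exact: trk_nondeg.
Qed.

Lemma sum_form (y : vT) : \sum_(x : vT) psi (- form y x) = (y == 0)%:R * #|vT|%:R.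
Proof.
have symE x : - form y x = - form x y by rewrite hermC /= expr0 mul1r.
under eq_bigr do rewrite symE.
apply: (@sum_psi_pairing p p_prime vT (fun x y => - form x y)).
- by move=> z x t; rewrite linearDl opprD.
- by move=> z x t; rewrite linearDr opprD.
by move=> z /(form_nondegP form_nondegenerate)[x xz]; exists x; rewrite oppr_eq0.
Qed.

Lemma K0_scale (z : qT) (c : Fr) : c != 0 -> (c *: z \in K0) = (z \in K0).
Proof.
move=> c0; apply/idP/idP; last exact: memvZ.
by move/(memvZ c^-1); rewrite scalerA mulVf // scale1r.
Qed.

Lemma in_perp (w : qT) :
  (w \in perp p k K0) = [forall z : qT, (z \in K0) ==> (trk (z * w) == 0)].
Proof. by rewrite inE. Qed.

Local Notation K0n := (#|[set z : qT | z \in K0]|%:R : algC).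

Lemma sum_K0 (w : qT) :
  \sum_(z : qT | z \in K0) psi (- trk (w * z))
    = (w \in perp p k K0)%:R * K0n.
Proof.
have fD : {morph (fun z : qT => - trk (w * z)) : x y / x + y}.
  by move=> x y; rewrite mulrDr trkD opprD.
rewrite in_perp; case: forallP => [w_perp|].
  rewrite mul1r -sum1_card natr_sum; apply: eq_big => z; first by rewrite inE.
  move=> zK; have := w_perp z; rewrite zK /= mulrC => /eqP ->.
  by rewrite oppr0 psi0.
move/forallP; rewrite negb_forall => /existsP[z]; rewrite negb_imply => /andP[zK wz].
rewrite mul0r; apply: (sum_psi_eq0 p_prime fD (x0 := z)).
  by move=> y; rewrite rpredDl.
by rewrite oppr_eq0 mulrC.
Qed.

Lemma card_K0_neq0 : K0n != 0 :> algC.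
Proof. by rewrite pnatr_eq0 -lt0n; apply/card_gt0P; exists 0; rewrite inE mem0v. Qed.

Lemma q_neq0 : q != 0.
Proof. by rewrite pnatr_eq0 -lt0n; apply/card_gt0P; exists 0. Qed.

(** By [sum_K0] the transform of the indicator of [K0] is a multiple of the indicator of [perp];
    inverting it gives the sum over [perp]. *)
Lemma sum_perp (v : qT) :
  \sum_(y in perp p k K0) psi (- trk (v * y)) = (v \in K0)%:R * (q / K0n).
Proof.
apply: (mulfI card_K0_neq0); rewrite mulrCA [K0n * (_ / _)]mulrC divfK ?card_K0_neq0 //.
have Bl (y : qT) : {morph (fun x : qT => - trk (x * y)) : x z / x + z}.
  by move=> x z; rewrite mulrDl trkD opprD.
have Br (x : qT) : {morph (fun y : qT => - trk (x * y)) : y z / y + z}.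
  by move=> y z; rewrite mulrDr trkD opprD.
have Bn (y : qT) : y != 0 -> exists x : qT, - trk (x * y) != 0.
  by case/trk_nondeg=> x xy; exists x; rewrite oppr_eq0.
(* Inversion at [- v] produces the exponent [- trk (v * y)]; [K0] is stable under negation. *)
have := fourier_inversion p_prime Bl Br Bn (fun z => (z \in K0)%:R) (- v).
rewrite rpredN mulrC => <-; rewrite mulr_sumr big_mkcond.
apply: eq_bigr => y _.
have -> : \sum_(z : qT) (z \in K0)%:R * psi (- trk (y * z))
    = \sum_(z : qT | z \in K0) psi (- trk (y * z)).
  rewrite [RHS]big_mkcond; apply: eq_bigr => z _.
  by case: ifP; rewrite ?mul1r ?mul0r.
rewrite sum_K0 mulrN trkN opprK [v * y]mulrC.
by case: ifP => _; rewrite [RHS]mulrC ?mul1r ?mul0r ?mul0r.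
Qed.

Lemma sum_not_K0 (w : qT) :
  \sum_(z : qT | z \notin K0) psi (- trk (w * z))
    = (w == 0)%:R * q - (w \in perp p k K0)%:R * K0n.
Proof.
(* Replacing [w == 0] by [- w == 0] makes [sum_trk] yield the negated exponents. *)
rewrite -oppr_eq0 -sum_trk -sum_K0; apply: canRL (addrK _) _.
rewrite addrC [RHS](bigID (fun z => z \in K0)) /=.
by congr (_ + _); apply: eq_bigr => z _; rewrite mulrN trkN mulrC.
Qed.

(** * Character sums of the cells expressed through Walsh transforms *)

Section Transforms.

Variables (P G : qT -> vT -> Fr) (eps : qT -> {unit Fr} -> int).
Variable sigma0 : {perm {unit Fr}}.
Local Notation N := (bent_abs V).
Local Notation walshP z t u :=
  (\sum_(x : vT) psi (trs (t * P z x)) * psi (- form u x)).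
Hypothesis P_scale : forall (z : qT) (c : Fr), c != 0 -> P (c *: z) =1 P z.
Hypothesis walsh_neq0 : forall (z : qT) (t : {unit Fr}) u, z != 0 ->
  walshP z (val t) u = (eps z t)%:~R * N * psi (trs ((val t)^-1 * G z u)).
Hypothesis walsh_eq0 : forall (t : {unit Fr}) u,
  walshP 0 (val t) u = (eps 0 t)%:~R * N * psi (trs (val (sigma0 t) * G 0 u)).

Definition level_transform (A : pred (ambient Fq V)) (h : ambient Fq V -> Fr) t xi :=
  \sum_(a | A a) psi (trs (t * h a)) * psi (- pairing xi a).

(** The variable [y] enters only through the trace of [y * (t *: z - v)], so summing over it leaves
    the factor [q] and the condition [t *: z = v]; the sum over [x] is a Walsh sum. *)
Lemma H_transform (A : pred qT) t (u : vT) (v w : qT) :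
  level_transform (fun a => A a.2) (Hfun k s P) t (u, v, w)
  = \sum_(z | A z && (t *: z == v)) psi (- trk (w * z)) * walshP z t u * q.
Proof.
rewrite /level_transform sum_ambient big_mkcondr; apply: eq_bigr => z _.
have termE (x : vT) (y : qT) :
    psi (trs (t * Hfun k s P (x, y, z))) * psi (- pairing (u, v, w) (x, y, z))
    = psi (- trk (w * z)) * (psi (trs (t * P z x)) * psi (- form u x))
      * psi (trk (y * (t *: z - v))).
  rewrite -!psiD //; congr psi; rewrite /= mulrDr trsD -TrZ -trk_rel mulrBr trkD trkN.
  rewrite -scalerAr [v * y]mulrC; ring.
under eq_bigr do under eq_bigr do rewrite termE.
under eq_bigr do rewrite -mulr_sumr sum_trk subr_eq0.
rewrite -mulr_suml -mulr_sumr; case: ifP => _; first by rewrite mul1r.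
by rewrite mul0r mulr0.
Qed.

(** The only surviving index is [z = t^-1 *: v]. By [P_scale] it may be replaced by [v] in [P], and
    the exponents [t^-1 * G v u] and [- trk (w * z)] add up to the trace of [t^-1 * Kfun]. *)
Lemma H_transform_unit (A : pred qT) (t : {unit Fr}) (u : vT) (v w : qT) :
    (forall z c, c != 0 -> A (c *: z) = A z) -> (forall z, A z -> z != 0) ->
  level_transform (fun a => A a.2) (Hfun k s P) (val t) (u, v, w)
  = (A v)%:R * ((eps v t)%:~R * N * q * psi (trs ((val t)^-1 * Kfun k s G (u, v, w)))).
Proof.
move=> A_scale A_neq0; rewrite H_transform.
have t0 : val t != 0 by rewrite -unitfE; apply: valP.
rewrite big_mkcondl (eq_bigl (pred1 ((val t)^-1 *: v))) => [|z]; last first.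
  apply/eqP/eqP => [<-|->]; first by rewrite scalerA mulVf // scale1r.
  by rewrite scalerA mulfV // scale1r.
rewrite big_pred1_eq A_scale ?invr_eq0 //; case: ifP => [Av|]; last by rewrite mul0r.
under eq_bigr do rewrite P_scale ?invr_eq0 //.
rewrite walsh_neq0 ?A_neq0 // mul1r /= mulrBr -TrZ trsD trsN -trk_rel psiD //.
have AC (R : comNzRingType) (a b c d e : R) : a * (b * c * d) * e = b * c * e * (d * a).
  by ring.
rewrite -scalerAr [w * v]mulrC; exact: AC.
Qed.

Lemma walshP0E z u : walshP z 0 u = (u == 0)%:R * #|vT|%:R.
Proof.
rewrite -sum_form; apply: eq_bigr => x _; rewrite mul0r.
by rewrite (additive_fun0 trsD) psi0 mul1r.
Qed.

(** At [t = 0] the condition on [z] degenerates to [v = 0] and the weight is trivial, so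
    orthogonality in [x] leaves [u = 0] and a character sum over [A]. *)
Lemma H_transform0 (A : pred qT) (u : vT) (v w : qT) :
  level_transform (fun a => A a.2) (Hfun k s P) 0 (u, v, w)
  = (v == 0)%:R * (u == 0)%:R * (#|vT|%:R * q) * \sum_(z | A z) psi (- trk (w * z)).
Proof.
rewrite H_transform.
have AC (R : comNzRingType) (a b c d : R) : a * (b * c) * d = b * (c * d) * a.
  by ring.
under eq_bigr do rewrite walshP0E.
rewrite (eq_bigl (fun z => A z && (v == 0))) => [|z]; last by rewrite scale0r eq_sym.
have [v0|v0] := eqVneq v 0; last by rewrite big_pred0 ?mul0r // => z; rewrite andbF.
rewrite mul1r mulr_sumr; apply: eq_big => [z|z _]; first by rewrite andbT.
exact: AC.
Qed.

(** The free coordinate [y] gives the factor [v == 0], and excluding [x = 0] subtracts a term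
    independent of [u]. *)
Lemma E_transform t (u : vT) (v w : qT) :
  level_transform (fun a => (a.2 == 0) && (a.1.1 != 0)) (fun a => P 0 a.1.1) t (u, v, w)
  = (v == 0)%:R * q * (walshP 0 t u - psi (trs (t * P 0 0))).
Proof.
transitivity (\sum_(z : qT | z == 0) \sum_(x : vT) \sum_(y : qT)
   (x != 0)%:R * (psi (trs (t * P 0 x)) * psi (- form u x) * psi (trk (y * - v)))).
  rewrite /level_transform.
  rewrite -(sum_ambient (fun z => z == 0) (fun a => (a.1.1 != 0)%:R *
    (psi (trs (t * P 0 a.1.1)) * psi (- form u a.1.1) * psi (trk (a.1.2 * - v))))).
  rewrite big_mkcondr; apply: eq_bigr => -[[x y] z] /= /eqP ->.
  case: ifP => _; last by rewrite mul0r.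
  rewrite mul1r -!psiD //; congr psi; rewrite /=.
  by rewrite mulr0 trk0 mulrN trkN [v * y]mulrC; ring.
rewrite big_pred1_eq.
under eq_bigr do under eq_bigr do rewrite mulrA.
under eq_bigr do rewrite -mulr_sumr sum_trk oppr_eq0.
rewrite -mulr_suml mulrC; congr (_ * _).
rewrite [in RHS](bigD1 0) //= linear0r oppr0 psi0 mulr1 addrC addrK.
rewrite [RHS]big_mkcond; apply: eq_bigr => x _.
by case: ifP => _; rewrite ?mul1r ?mul0r.

Qed.

Lemma sum_axis (B : pred qT) (F : ambient Fq V -> algC) :
  \sum_(a | [&& a.1.1 == 0, a.2 == 0 & B a.1.2]) F a = \sum_(y | B y) F (0, y, 0).
Proof.
rewrite (reindex_onto (fun y : qT => (0, y, 0) : ambient Fq V) (fun a => a.1.2)).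
  by apply: eq_bigl => y /=; rewrite !eqxx andbT.
by case=> -[x y] z /= /and3P[/eqP-> /eqP-> _].
Qed.

Lemma perp0 : 0 \in perp p k K0.
Proof. by rewrite in_perp; apply/forallP=> z; rewrite mulr0 trk0 eqxx implybT. Qed.

Lemma pairing_axis (u : vT) (v w y : qT) : pairing (u, v, w) (0, y, 0) = trk (v * y).
Proof. by rewrite /= linear0r mulr0 trk0 add0r addr0. Qed.

Lemma chi_B1 (u : vT) (v w : qT) :
  chi pairing (u, v, w)
    [set a | [&& a.1.1 == 0, a.2 == 0, a.1.2 \in perp p k K0 & a.1.2 != 0]]
  = (v \in K0)%:R * (q / K0n) - 1.
Proof.
rewrite -sum_perp [in RHS](bigD1 0) ?perp0 //= mulr0 trk0 oppr0 psi0 addrC addrK.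
rewrite /chi (eq_bigl _ _ (in_set _)).
rewrite (sum_axis (fun y => (y \in perp p k K0) && (y != 0))).
by apply: eq_bigr => y _; rewrite pairing_axis.
Qed.

Lemma chi_B2 (u : vT) (v w : qT) :
  chi pairing (u, v, w)
    [set a | [&& a.1.1 == 0, a.2 == 0 & a.1.2 \notin perp p k K0]]
  = (v == 0)%:R * q - (v \in K0)%:R * (q / K0n).
Proof.
rewrite -oppr_eq0 -sum_trk -sum_perp; apply: canRL (addrK _) _.
rewrite /chi (eq_bigl _ _ (in_set _)) (sum_axis (fun y => y \notin perp p k K0)).
under eq_bigr do rewrite pairing_axis.
rewrite addrC [RHS](bigID (mem (perp p k K0))) /=.
by congr (_ + _); apply: eq_bigr => y _; rewrite [y * _]mulrC mulNr trkN.
Qed.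

Lemma chi_origin xi :
  chi pairing xi [set a | [&& a.1.1 == 0, a.1.2 == 0 & a.2 == 0]] = 1.
Proof.
case: xi => -[u v] w; rewrite /chi (eq_bigl _ _ (in_set _)).
rewrite (eq_bigl (fun a : ambient Fq V => [&& a.1.1 == 0, a.2 == 0 & a.1.2 == 0])).
  by rewrite (sum_axis (pred1 0)) big_pred1_eq pairing_axis mulr0 trk0 oppr0.
by move=> a; congr (_ && _); rewrite andbC.
Qed.

(** A multiplier with nonzero trace on [a - b] cannot be 0, so testing units is enough. *)
Lemma trs_sep (a b : Fr) :
  (forall t : {unit Fr}, trs (val t * a) = trs (val t * b)) -> a = b.
Proof.
move=> eq_ab; apply/eqP; rewrite -subr_eq0; apply/negP=> /negP.
case/(abs_trace_nondegenerate p_prime s_gt0 card_Fr) => y.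
have [->|y0] := eqVneq y 0.
  by rewrite mul0r (additive_fun0 trsD) eqxx.
have yU : y \is a GRing.unit by rewrite unitfE.
by rewrite mulrBr trsD trsN (eq_ab (FinRing.Unit yU)) subrr eqxx.
Qed.

Hypotheses (P00 : P 0 0 = 0) (G00 : G 0 0 = 0).
Hypothesis epsP : forall z t, eps z t = 1 \/ eps z t = -1.
Variables eps1 eps2 : {unit Fr} -> int.
Hypothesis eps_K1 : forall z t, z \notin K0 -> eps z t = eps1 t.
Hypothesis eps_K0 : forall z t, z \in K0 -> z != 0 -> eps z t = eps2 t.

Local Notation W := (perp p k K0).
Local Notation H_label a := (cell_label K0 W a.1.1 a.1.2 a.2 (Hfun k s P a) (P 0 a.1.1)).
Local Notation K_label a := (cell_label K0 W a.1.1 a.2 a.1.2 (Kfun k s G a) (G 0 a.1.1)).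

Let A1 (z : qT) := z \notin K0.
Let A2 (z : qT) := (z \in K0) && (z != 0).

Let A1_scale z c : c != 0 -> A1 (c *: z) = A1 z.
Proof. by move=> c0; rewrite /A1 K0_scale. Qed.
Let A2_scale z c : c != 0 -> A2 (c *: z) = A2 z.
Proof. by move=> c0; rewrite /A2 K0_scale // scaler_eq0 negb_or c0. Qed.
Let A1_neq0 z : A1 z -> z != 0.
Proof. by apply: contraNneq => ->; apply: mem0v. Qed.
Let A2_neq0 z : A2 z -> z != 0. Proof. by case/andP. Qed.

Lemma sum_A2 (w : qT) :
  \sum_(z | A2 z) psi (- trk (w * z)) = (w \in W)%:R * K0n - 1.
Proof.
by rewrite -sum_K0 [in RHS](bigD1 0) ?mem0v //= mulr0 trk0 oppr0 addrC addrK.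
Qed.

Lemma Fr_unitP (R : Fr -> Prop) :
  R 0 -> (forall t : {unit Fr}, R (val t)) -> forall t, R t.
Proof.
move=> R0 RU t; have [->//|t0] := eqVneq t 0.
have tU : t \is a GRing.unit by rewrite unitfE.
exact: RU (FinRing.Unit tU).
Qed.

Lemma natb_inj (b b' : bool) : b%:R = b'%:R :> algC -> b = b'.
Proof. by move/eqP; rewrite eqr_nat; case: b b' => -[]. Qed.

Lemma eps_neq0 z t : (eps z t)%:~R * N * q != 0 :> algC.
Proof.
rewrite !mulf_neq0 ?q_neq0 ?bent_abs_neq0 // intr_eq0.
by case: (epsP z t) => ->.
Qed.

Lemma vT_neq0 : #|vT|%:R != 0 :> algC.
Proof. by rewrite pnatr_eq0 -lt0n; apply/card_gt0P; exists 0. Qed.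

(** Signs on [A] depend on [t] alone, so the factor in front of [psi] is common to both sides and
    cancels; the remaining traces over all units determine the value of [Kfun]. *)
Lemma H_transform_inj (A : pred qT) (xi eta : ambient Fq V) :
    (forall z c, c != 0 -> A (c *: z) = A z) -> (forall z, A z -> z != 0) ->
    (forall z z' t, A z -> A z' -> eps z t = eps z' t) ->
    A xi.1.2 -> A eta.1.2 ->
    (forall t : {unit Fr},
      level_transform (fun a => A a.2) (Hfun k s P) (val t) xi
      = level_transform (fun a => A a.2) (Hfun k s P) (val t) eta) <->
  Kfun k s G xi = Kfun k s G eta.
Proof.
case: xi => -[u v] w; case: eta => -[u' v'] w' /= A_scale A_n0 A_eps Av Av'.
split=> [eqT|eqK t]; last first.
  by rewrite !H_transform_unit // Av Av' /= eqK (A_eps v v').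
apply: trs_sep => t; apply: (psi_inj p_prime).
(* The transform at parameter [t] carries [t^-1 * Kfun], hence the inverse parameter here. *)
have := eqT (t^-1)%g; rewrite !H_transform_unit // Av Av' !mul1r (A_eps v v') //.
by move/(mulfI (eps_neq0 _ _)); rewrite FinRing.val_unitV invrK.
Qed.
(** B_1 reveals whether [v] is in [K0], then B_2 whether [v = 0]. For [v != 0] the cells c or d give
    the value of [Kfun]. For [v = 0] the cells e give [u == 0] at [t = 0] and [G 0 u] at units [t].
    If also [u = 0], the cells d at [t = 0] reveal whether [w] is in [W], and then the cells c
    whether [w = 0]. The converse reads the same formulas backwards. *)
Lemma chi_cells_label (xi eta : ambient Fq V) :
  (forall l, chi pairing xi ((fun a : ambient Fq V => H_label a) @^-1: [set l])
           = chi pairing eta ((fun a : ambient Fq V => H_label a) @^-1: [set l]))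
  <-> K_label xi = K_label eta.
Proof.
have setA1 i : [set a : ambient Fq V | (a.2 \notin K0) && (Hfun k s P a == i)]
  = [set a | A1 a.2 && (Hfun k s P a == i)] by [].
have setA2 i : [set a : ambient Fq V | [&& a.2 \in K0, a.2 != 0 & Hfun k s P a == i]]
  = [set a | A2 a.2 && (Hfun k s P a == i)].
  by apply/setP=> a; rewrite !inE /A2 andbA.
have setE i : [set a : ambient Fq V | [&& a.2 == 0, a.1.1 != 0 & P 0 a.1.1 == i]]
  = [set a | ((a.2 == 0) && (a.1.1 != 0)) && (P 0 a.1.1 == i)].
  by apply/setP=> a; rewrite !inE andbA.
have eps_A1 z z' t : A1 z -> A1 z' -> eps z t = eps z' t.
  by move=> *; rewrite !eps_K1.
have eps_A2 z z' t : A2 z -> A2 z' -> eps z t = eps z' t.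
  by move=> /andP[z1 z2] /andP[z1' z2']; rewrite !eps_K0.
have c_neq0 : q / K0n != 0 by rewrite mulf_neq0 ?q_neq0 // invr_eq0 card_K0_neq0.
have levelP A h := level_chiP p_prime s_gt0 card_Fr pairing A h xi eta.
rewrite (cell_label_eqP _ _ _ _ _ _ _ _ _ _ _ perp0).
split=> [eq_chi|].
  have /levelP T1 i : chi pairing xi [set a | A1 a.2 && (Hfun k s P a == i)]
      = chi pairing eta [set a | A1 a.2 && (Hfun k s P a == i)].
    by have := eq_chi (inl i); rewrite !preim_cell_label ?perp0 // !setA1.
  have /levelP T2 i : chi pairing xi [set a | A2 a.2 && (Hfun k s P a == i)]
      = chi pairing eta [set a | A2 a.2 && (Hfun k s P a == i)].
    by have := eq_chi (inr (inl i)); rewrite !preim_cell_label ?perp0 // !setA2.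
  have /levelP TE i :
      chi pairing xi [set a | ((a.2 == 0) && (a.1.1 != 0)) && (P 0 a.1.1 == i)]
      = chi pairing eta [set a | ((a.2 == 0) && (a.1.1 != 0)) && (P 0 a.1.1 == i)].
    by have := eq_chi (inr (inr (inl i))); rewrite !preim_cell_label ?perp0 // !setE.
  have := eq_chi (inr (inr (inr (inl tt)))).
  have := eq_chi (inr (inr (inr (inr (inl tt))))).
  rewrite !preim_cell_label ?perp0 // {eq_chi}.
  case: xi eta T1 T2 TE {levelP} => -[u v] w [[u' v'] w'] T1 T2 TE /=.
  rewrite !chi_B1 !chi_B2 => /addIr/(mulIf c_neq0)/natb_inj vK.
  rewrite vK => /addIr/(mulIf q_neq0)/natb_inj v0; split=> // [v_n0|v_0].
    have v'_n0 : v' != 0 by rewrite -v0.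
    have [vK1|vK1] := boolP (v \in K0).
      apply/(H_transform_inj (xi := (u, v, w)) (eta := (u', v', w')) A2_scale A2_neq0 eps_A2).
      - by rewrite /A2 /= vK1.
      - by rewrite /A2 /= -vK vK1.
      by move=> t; apply: T2.
    apply/(H_transform_inj (xi := (u, v, w)) (eta := (u', v', w')) A1_scale A1_neq0 eps_A1).
    - by rewrite /A1 /=.
    - by rewrite /A1 /= -vK.
    by move=> t; apply: T1.
  have v'_0 : v' = 0 by apply/eqP; rewrite -v0 v_0.
  rewrite v_0 v'_0 in T1 T2 TE.
  have u0 : (u == 0) = (u' == 0).
    have := TE 0; rewrite -!/(level_transform _ _ _ _) !E_transform !walshP0E eqxx mul1r.
    by move/(mulfI q_neq0)/addIr/(mulIf vT_neq0)/natb_inj.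
  split=> // [_|u_0].
    apply: trs_sep => t; apply: (psi_inj p_prime).
    (* The Walsh exponent of [P 0] at a parameter involves its image under [sigma0]; the preimage of
       [t] is taken so that [t] itself appears. *)
    have := TE (val (sigma0^-1 t)%g).
    rewrite -!/(level_transform _ _ _ _) !E_transform !walsh_eq0 permKV eqxx mul1r.
    by move/(mulfI q_neq0)/addIr/mulfI; apply; have := eps_neq0 0 (sigma0^-1 t)%g;
      rewrite mulf_eq0 negb_or => /andP[].
  have u'_0 : u' = 0 by apply/eqP; rewrite -u0 u_0.
  rewrite u_0 u'_0 in T1 T2.
  have vq_neq0 : (#|vT|%:R * q : algC) != 0 by rewrite mulf_neq0 ?vT_neq0 ?q_neq0.
  have wW : (w \in W) = (w' \in W).
    have := T2 0; rewrite -!/(level_transform _ _ _ _) !H_transform0 !eqxx !mul1r !sum_A2.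
    by move/(mulfI vq_neq0)/addIr/(mulIf card_K0_neq0)/natb_inj.
  split=> //.
  have := T1 0; rewrite -!/(level_transform _ _ _ _) !H_transform0 !eqxx !mul1r !sum_not_K0 wW.
  by move/(mulfI vq_neq0)/addIr/(mulIf q_neq0)/natb_inj.
case: xi eta levelP => -[u v] w [[u' v'] w'] levelP /= [vK v0 eqK eq0] l.
rewrite preim_cell_label ?perp0 //; case: l => [i|[i|[i|[_|[_|_]]]]].
- rewrite setA1; move: i; apply/levelP; apply: Fr_unitP => [|t].
    rewrite -!/(level_transform _ _ _ _) !H_transform0 !sum_not_K0 -v0.
    have [/eq0[<- _ eqw]|] := eqVneq v 0; last by rewrite !mul0r.
    by have [/eqw[-> ->]|] := eqVneq u 0; rewrite ?mulr0 ?mul0r.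
  have [Av|Av] := boolP (A1 v); last first.
    (* When [v] is outside the region, so is [v'], and both transforms vanish. *)
    rewrite -!/(level_transform _ _ _ _) !H_transform_unit //.
    by rewrite {2}/A1 -vK -/(A1 v) (negPf Av) !mul0r.
  apply: (proj2 (H_transform_inj (xi := (u, v, w)) (eta := (u', v', w'))
    A1_scale A1_neq0 eps_A1 _ _)) => //.
    by rewrite /A1 /= -vK.
  exact: eqK (A1_neq0 Av).
- rewrite setA2; move: i; apply/levelP; apply: Fr_unitP => [|t].
    rewrite -!/(level_transform _ _ _ _) !H_transform0 !sum_A2 -v0.
    have [/eq0[<- _ eqw]|] := eqVneq v 0; last by rewrite !mul0r.
    by have [/eqw[-> _]|] := eqVneq u 0; rewrite ?mulr0 ?mul0r.
  have [Av|Av] := boolP (A2 v); last first.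
    rewrite -!/(level_transform _ _ _ _) !H_transform_unit //.
    by rewrite {2}/A2 -vK -v0 -/(A2 v) (negPf Av) !mul0r.
  apply: (proj2 (H_transform_inj (xi := (u, v, w)) (eta := (u', v', w'))
    A2_scale A2_neq0 eps_A2 _ _)) => //.
    by rewrite /A2 /= -vK -v0.
  exact: eqK (A2_neq0 Av).
- rewrite setE; move: i; apply/levelP => t.
  rewrite -!/(level_transform _ _ _ _) !E_transform -v0.
  have [/eq0[u0 eqG _]|] := eqVneq v 0; last by rewrite !mul0r.
  congr (_ * (_ - _)); move: t; apply: Fr_unitP => [|t].
    by rewrite !walshP0E u0.
  rewrite !walsh_eq0; suff -> : G 0 u = G 0 u' by [].
  have [u_0|] := eqVneq u 0; last exact: eqG.
  by move: u0; rewrite u_0 eqxx => /esym/eqP->.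
- by rewrite !chi_B2 vK v0.
- by rewrite !chi_B1 vK.
by rewrite !chi_origin.
Qed.

Lemma OmegaH_cells : OmegaH k s K0 P
  = cells K0 W (fun a : ambient Fq V => a.1.1) (fun a => a.1.2) (fun a => a.2)
      (Hfun k s P) (fun a => P 0 a.1.1).
Proof.
rewrite /OmegaH /cells; congr (_ :\ _); congr (_ :|: _ :|: _ :|: _).
- congr [set _; _; _].
  + by apply/setP=> -[[x y] z]; rewrite !inE andbA.
  + by apply/setP=> -[[x y] z]; rewrite !inE.
  by apply/setP=> -[[x y] z]; rewrite !inE.
- by apply: eq_imset => i; apply/setP=> -[[x y] z]; rewrite !inE.
- by apply: eq_imset => i; apply/setP=> -[[x y] z]; rewrite !inE.
by apply: eq_imset => i; apply/setP=> -[[x y] z]; rewrite !inE.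
Qed.

Lemma OmegaK_cells : OmegaK k s K0 G
  = cells K0 W (fun a : ambient Fq V => a.1.1) (fun a => a.2) (fun a => a.1.2)
      (Kfun k s G) (fun a => G 0 a.1.1).
Proof.
rewrite /OmegaK /cells; congr (_ :\ _); congr (_ :|: _ :|: _ :|: _).
- congr [set _; _; _].
  + by apply/setP=> -[[x y] z]; rewrite !inE [X in _ && X]andbC andbA.
  + by apply/setP=> -[[x y] z]; rewrite !inE.
  by apply/setP=> -[[x y] z]; rewrite !inE.
- by apply: eq_imset => i; apply/setP=> -[[x y] z]; rewrite !inE.
- by apply: eq_imset => i; apply/setP=> -[[x y] z]; rewrite !inE.
by apply: eq_imset => i; apply/setP=> -[[x y] z]; rewrite !inE.
Qed.

Lemma OmegaH_label :
  OmegaH k s K0 P = preim_partition (fun a : ambient Fq V => H_label a) setT.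
Proof. by rewrite OmegaH_cells (cellsE _ _ _ _ _ _ perp0). Qed.

Lemma OmegaK_label :
  OmegaK k s K0 G = preim_partition (fun a : ambient Fq V => K_label a) setT.
Proof. by rewrite OmegaK_cells (cellsE _ _ _ _ _ _ perp0). Qed.

(** Labels with empty preimage are not cells, but their character sums are 0 everywhere, so
    agreement on cells and agreement on labels coincide. *)
Lemma dual_OmegaH :
  dual_partition pairing (OmegaH k s K0 P) = OmegaK k s K0 G.
Proof.
rewrite OmegaK_label; apply: eq_imset => xi; apply/setP=> eta; rewrite !inE /=.
apply/forall_inP/eqP => [eq_chi|/chi_cells_label eq_chi U].
  apply/chi_cells_label => l.
  have [->|l_n0] := eqVneq ((fun a : ambient Fq V => H_label a) @^-1: [set l]) set0.
    by rewrite /chi !big_set0.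
  by apply/eqP/eq_chi; rewrite OmegaH_label preim_partitionE in_setD1 l_n0 imset_f.
rewrite OmegaH_label preim_partitionE in_setD1 => /andP[_ /imsetP[l _ ->]].
by apply/eqP.
Qed.

(** * Counting the cells of the two partitions *)

Lemma card_perp : (#|W| * #|[set z : qT | z \in K0]| = #|qT|)%N.
Proof.
apply/eqP; rewrite -(eqr_nat algC) natrM.
have -> : #|W|%:R = q / K0n.
  have := sum_perp 0; rewrite mem0v mul1r => <-.
  rewrite -sum1_card natr_sum; apply: eq_bigr => y _.
  by rewrite mul0r trk0 oppr0 psi0.
by rewrite divfK ?card_K0_neq0.
Qed.

Lemma exists_nonzero (S : {set qT}) : 0 \in S ->
  [exists v, (v \in S) && (v != 0)] = (1 < #|S|)%N.
Proof.
move=> S0; rewrite (cardsD1 0) S0 add1n ltnS lt0n cards_eq0.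
by apply/existsP/set0Pn => -[v vS]; exists v; move: vS; rewrite in_setD1 andbC.
Qed.

Lemma exists_notin (S : {set qT}) : [exists v, v \notin S] = (#|S| < #|qT|)%N.
Proof.
rewrite -(cardsC S) -[ltnLHS]addn0 ltn_add2l lt0n cards_eq0.
by apply/existsP/set0Pn => -[v vS]; exists v; move: vS; rewrite in_setC.
Qed.

Lemma exists_notin_K0 : [exists w : qT, w \notin K0] = (K0 != fullv).
Proof.
apply/existsP/idP => [[w]|]; first by apply: contraNneq => ->; apply: memvf.
move=> K0_proper; have /subvPn[w _ wK] : ~~ (fullv <= K0)%VS.
  by apply: contra K0_proper => ?; rewrite eqEsubv subvf.
by exists w.
Qed.

Lemma exists_K0_neq0 : [exists w : qT, (w \in K0) && (w != 0)] = (K0 != 0%VS).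
Proof.
apply/existsP/idP => [[w /andP[wK w0]]|K_n0].
  by apply: contraNneq w0 => K00; move: wK; rewrite K00 memv0.
by exists (vpick K0); rewrite memv_pick vpick0.
Qed.

(** By [card_perp], [W] has more than one element exactly when [K0] has fewer elements than the
    whole field. *)
Lemma exists_perp_neq0 : [exists v, (v \in W) && (v != 0)] = (K0 != fullv).
Proof.
rewrite exists_nonzero ?perp0 // -exists_notin_K0.
rewrite (eq_existsb (P2 := fun w => w \notin [set z : qT | z \in K0])); last first.
  by move=> w; rewrite inE.
rewrite exists_notin -card_perp -{1}[#|[set z : qT | z \in K0]|]mul1n ltn_pmul2r //.
by apply/card_gt0P; exists 0; rewrite inE mem0v.
Qed.

Lemma exists_notin_perp : [exists v, v \notin W] = (K0 != 0%VS).
Proof.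
rewrite exists_notin -exists_K0_neq0.
rewrite (eq_existsb (P2 := fun w => (w \in [set z : qT | z \in K0]) && (w != 0))); last first.
  by move=> w; rewrite inE.
rewrite exists_nonzero ?inE ?mem0v // -card_perp.
rewrite -{1}[#|W|]muln1 ltn_pmul2l //.
by apply/card_gt0P; exists 0; apply: perp0.
Qed.

Local Notation values Q := #|[set i : Fr | [exists x : vT, (x != 0) && (Q x == i)]]|.

Lemma card_OmegaH : #|OmegaH k s K0 P| =
  ((K0 != fullv) * #|Fr| + ((K0 != 0%VS) * #|Fr|
    + (values (P 0%R) + ((K0 != 0%VS) + ((K0 != fullv) + 1)))))%N.
Proof.
rewrite OmegaH_cells.
apply: (card_cells (x := fun a : ambient Fq V => a.1.1) (y := fun a => a.1.2)
  (z := fun a => a.2) (g := fun a => P 0 a.1.1)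
  perp0 (mk := fun u v w => (u, v, w)) (Q := P 0)) => //.
- move=> u w i w0.
  have [v vE] := rel_trace_surjective p_prime m_gt0 card_Fr card_Fq' (i - P w u) w0.
  by exists v; rewrite /= vE addrC subrK.
- exact: exists_notin_K0.
- exact: exists_K0_neq0.
- exact: exists_perp_neq0.
exact: exists_notin_perp.
Qed.

Lemma card_OmegaK : #|OmegaK k s K0 G| =
  ((K0 != fullv) * #|Fr| + ((K0 != 0%VS) * #|Fr|
    + (values (G 0%R) + ((K0 != 0%VS) + ((K0 != fullv) + 1)))))%N.
Proof.
rewrite OmegaK_cells.
apply: (card_cells (x := fun a : ambient Fq V => a.1.1) (y := fun a => a.2)
  (z := fun a => a.1.2) (g := fun a => G 0 a.1.1)
  (* [mk] exchanges the last two coordinates, since the regions of [OmegaK] are cut out by the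
     middle one. *)
  perp0 (mk := fun u v w => (u, w, v)) (Q := G 0)) => //.
- move=> u w i w0.
  have [v vE] := rel_trace_surjective p_prime m_gt0 card_Fr card_Fq' (G w u - i) w0.
  by exists v; rewrite /= [w * v]mulrC vE subKr.
- exact: exists_notin_K0.
- exact: exists_K0_neq0.
- exact: exists_perp_neq0.
exact: exists_notin_perp.
Qed.

Lemma sum_P0 (t : {unit Fr}) :
  \sum_(x : vT) psi (trs (val t * P 0 x)) = (eps 0 t)%:~R * N.
Proof.
have := walsh_eq0 t 0; rewrite G00 mulr0 (additive_fun0 trsD) psi0 mulr1 => <-.
by apply: eq_bigr => x _; rewrite linear0l oppr0 psi0 mulr1.
Qed.

Hypothesis card_vT : #|vT|%:R = N * N.

(* Summing the Walsh transform of P 0 over all frequencies recovers its value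
   at 0, by Fourier inversion. *)
Lemma sum_G0 (t : {unit Fr}) :
  \sum_(x : vT) psi (trs (val t * G 0 x)) = (eps 0 (sigma0^-1 t)%g)%:~R * N.
Proof.
set tau := (sigma0^-1 t)%g.
have eN : (eps 0 tau)%:~R * N != 0 :> algC.
  by have := eps_neq0 0 tau; rewrite mulf_eq0 negb_or => /andP[].
(* After multiplication by the Walsh factor of [tau], the left side is the sum of all Walsh values
   of that component and, the sign squaring to 1, the right side is [N * N]. *)
apply: (mulfI eN); rewrite mulr_sumr.
have ee : (eps 0 tau)%:~R * (eps 0 tau)%:~R = 1 :> algC.
  by case: (epsP 0 tau) => ->; rewrite ?mulr1 // mulrNN mulr1.
transitivity (N * N); last by rewrite mulrACA ee mul1r.
rewrite -card_vT.
transitivity (\sum_(u : vT) walshP 0 (val tau) u).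
  by apply: eq_bigr => u _; rewrite walsh_eq0 permKV.
have Bl (y : vT) : {morph (fun x : vT => - form x y) : x z / x + z}.
  by move=> x z; rewrite linearDl opprD.
have Br (x : vT) : {morph (fun y : vT => - form x y) : y z / y + z}.
  by move=> y z; rewrite linearDr opprD.
have Bn (y : vT) : y != 0 -> exists x : vT, - form x y != 0.
  by case/(form_nondegP form_nondegenerate)=> x xy; exists x; rewrite oppr_eq0.
have := fourier_inversion p_prime Bl Br Bn (fun x => psi (trs (val tau * P 0 x))) 0.
rewrite P00 mulr0 (additive_fun0 trsD) psi0 mulr1 => <-.
by apply: eq_bigr => u _; rewrite linear0r oppr0 oppr0 psi0 mul1r.
Qed.

(** Invariance under scaling by -1 gives [P (- z) = P z], evenness takes care of [x], and the
    product [y * z] does not change. *)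
Lemma OmegaH_opp : (forall z x, P z (- x) = P z x) ->
  forall U (a : ambient Fq V), U \in OmegaH k s K0 P -> a \in U -> - a \in U.
Proof.
move=> P_even U [[x y] z]; rewrite OmegaH_label preim_partitionE in_setD1.
case/andP=> _ /imsetP[l _ ->]; rewrite !inE /=.
have perpN (y' : qT) : (- y' \in W) = (y' \in W).
  by rewrite !in_perp; apply: eq_forallb => z'; rewrite mulrN trkN oppr_eq0.
have P_N z' x' : P (- z') x' = P z' x'.
  by rewrite -scaleN1r P_scale // oppr_eq0 oner_eq0.
rewrite /cell_label rpredN !oppr_eq0 perpN mulrNN.
by rewrite P_N !P_even.
Qed.
End Transforms.

End VectorialBent.

Theorem theorem4p3 (p k s n : nat)
    (Fr : finFieldType) (Fq : fieldExtType Fr)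
    (V : vectType 'F_p) (form : {symmetric V}) (K0 : {vspace Fq})
    (P G : finvect_type Fq -> finvect_type V -> Fr)
    (eps : finvect_type Fq -> {unit Fr} -> int) (eps1 eps2 : {unit Fr} -> int)
    (sigma0 : {perm {unit Fr}})
    (p_prime : prime p) (p_odd : odd p)
    (card_Fr : #|Fr| = (p ^ s)%N) (card_Fq : #|finvect_type Fq| = (p ^ k)%N)
    (s_dvd_k : (s %| k)%N)
    (dim_V : \dim {:V} = n) (n_even : ~~ odd n) (s_le : (s <= n./2)%N)
    (form_nondegenerate : nondegenerate form)
    (P_scale : forall (z : finvect_type Fq) (c : Fr), c != 0 ->
       P (c *: z) =1 P z)
    (P_weakly_regular : forall z,
       vectorial_bent form s (P z) /\
       weakly_regular_components form s (P z) (eps z))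
    (P_inversion : forall z, z != 0 -> inversion_type form s (P z) (G z))
    (P0_dual_bent : vectorial_dual_bent form s (P 0) (G 0) sigma0)
    (eps_K1 : forall z t, z \notin K0 -> eps z t = eps1 t)
    (eps_K0 : forall z t, z \in K0 -> z != 0 -> eps z t = eps2 t)
    (P00 : P 0 0 = 0) (G00 : G 0 0 = 0) :
  let pairing := ambient_form k (Fq := Fq) form in
  let Omega := OmegaH k s K0 P in
  let delta := if (n == 2 * s)%N && [forall t, eps 0 t == -1] then 0%N else 1%N in
  (fourier_reflexive pairing Omega /\
   dual_partition pairing Omega = OmegaK k s K0 G) /\
  ((forall z x, P z (- x) = P z x) ->
   let d := (#|Omega| - 1)%N in
   symmetric_association_scheme d (induced_relations Omega) /\
   d = if (K0 == 0%VS) || (K0 == fullv) then (2 * #|Fr| + delta)%N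
       else (3 * #|Fr| + 1 + delta)%N).
Proof.
move=> pairing Omega delta.
(* A field has at least two elements, which excludes the exponent 0 here and for [k] below. *)
have s_gt0 : (0 < s)%N.
  by case: (posnP s) => // s0; move: (finNzRing_gt1 Fr); rewrite card_Fr s0.
have k_gt0 : (0 < k)%N.
  case: (posnP k) => // k0.
  by move: (finNzRing_gt1 (finvect_type Fq)); rewrite card_Fq k0.
have p_gt1 := prime_gt1 p_prime.
have walsh_componentE (Q : finvect_type V -> Fr) (t : Fr) (u : finvect_type V) :
    walsh form (component s Q t) u
    = \sum_x psi (abs_trace p s (t * Q x : Fr)) * psi (- form u x).
  by apply: eq_bigr => x _; rewrite -psiD.
have epsP z t : eps z t = 1 \/ eps z t = -1.
  by have [_ /(_ t)[_ [fs /(_ 0)[]]]] := P_weakly_regular z.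
have walsh_neq0 (z : finvect_type Fq) (t : {unit Fr}) u : z != 0 ->
    \sum_x psi (abs_trace p s (val t * P z x : Fr)) * psi (- form u x)
    = (eps z t)%:~R * bent_abs V * psi (abs_trace p s ((val t)^-1 * G z u : Fr)).
  move=> /P_inversion[_ /(_ t) Pdual]; have [_ /(_ t) Pwr] := P_weakly_regular z.
  by rewrite -walsh_componentE; case: (weakly_regular_dual p_prime p_odd Pwr Pdual).
have walsh_eq0 (t : {unit Fr}) u :
    \sum_x psi (abs_trace p s (val t * P 0 x : Fr)) * psi (- form u x)
    = (eps 0 t)%:~R * bent_abs V * psi (abs_trace p s (val (sigma0 t) * G 0 u : Fr)).
  have [_ _ /(_ t) Pdual] := P0_dual_bent; have [_ /(_ t) Pwr] := P_weakly_regular 0.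
  by rewrite -walsh_componentE; case: (weakly_regular_dual p_prime p_odd Pwr Pdual).
set N := (p ^ (\dim {:V})./2)%N.
have card_vT : #|finvect_type V| = (N * N)%N.
  transitivity #|(fullv : {vspace finvect_type V})|.
    by apply: eq_card => x; rewrite memvf.
  rewrite card_vspace card_Fp // -expnD addnn even_halfK //.
  by move: n_even; rewrite -dim_V.
have card_vTR : #|finvect_type V|%:R = bent_abs V * bent_abs V by rewrite card_vT natrM.
(* The bound on [s] enters here; it guarantees that [P 0] and [G 0] attain every value. *)
have Fr_le_N : (#|Fr| <= N)%N by rewrite card_Fr /N dim_V leq_exp2l.
have N_eq : (N == #|Fr|) = (n == 2 * s)%N.
  by rewrite card_Fr /N dim_V eqn_exp2l //; lia.
pose all_neg := [forall t, eps 0 t == -1].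
pose card_values := if (n == 2 * s)%N && all_neg then #|Fr|.-1 else #|Fr|.
have valuesP : #|[set i : Fr | [exists x, (x != 0) && (P 0 x == i)]]| = card_values.
  rewrite (card_nonzero_values p_prime s_gt0 card_Fr card_vT Fr_le_N P00 (epsP 0)) ?N_eq //.
  move=> t; exact: (sum_P0 p_prime s_gt0 card_Fr walsh_eq0 G00).
(* The signs attached to [G 0] are those of [P 0] permuted by [sigma0], so they are all -1 for both
   functions or for neither; the two value counts therefore agree. *)
have valuesG : #|[set i : Fr | [exists x, (x != 0) && (G 0 x == i)]]| = card_values.
  rewrite (card_nonzero_values p_prime s_gt0 card_Fr card_vT Fr_le_N G00
    (fun t => epsP 0 (sigma0^-1 t)%g)); last first.
    exact: (sum_G0 p_prime s_gt0 card_Fr form_nondegenerate walsh_eq0 P00 epsP card_vTR).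
  rewrite N_eq /card_values /all_neg; congr (if _ && _ then _ else _).
  apply/forallP/forallP => neg t; last exact: neg.
  by have := neg (sigma0 t); rewrite permK.
have dualE : dual_partition pairing Omega = OmegaK k s K0 G.
  exact: (dual_OmegaH p_prime s_gt0 k_gt0 s_dvd_k card_Fr card_Fq form_nondegenerate
    P_scale walsh_neq0 walsh_eq0 epsP eps_K1 eps_K0).
have cardP := card_OmegaH K0 p_prime s_gt0 k_gt0 s_dvd_k card_Fr card_Fq P.
have cardG := card_OmegaK K0 p_prime s_gt0 k_gt0 s_dvd_k card_Fr card_Fq G.
have refl : fourier_reflexive pairing Omega.
  split; last by rewrite dualE /Omega cardP cardG valuesP valuesG.
    rewrite /Omega (OmegaH_label _ _ p_prime k_gt0 card_Fq); exact: preim_partitionP.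
  rewrite /Omega /OmegaH in_setD1 !inE eqxx /= andbT.
  by apply/set0Pn; exists 0; rewrite inE.
split=> // P_even d; split.
  apply: (fourier_reflexive_scheme p_prime
    (pairingDl form p_prime k_gt0 card_Fq) (pairingDr form p_prime k_gt0 card_Fq)
    (pairing_nondeg p_prime k_gt0 card_Fq form_nondegenerate) refl) => U a.
  exact: (OmegaH_opp p_prime k_gt0 card_Fq P_scale P_even).
have Fr_gt1 : (1 < #|Fr|)%N := finNzRing_gt1 Fr.
have full_neq0 : (fullv != 0%VS :> {vspace Fq}).
  by apply/eqP=> full0; have := memvf (1 : Fq); rewrite full0 memv0 oner_eq0.
rewrite /d /Omega cardP valuesP /card_values /delta /all_neg.
(* Either extreme choice of [K0] removes one family of [#|Fr|] cells together with B_1 or B_2, that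
   is [#|Fr| + 1] cells. The two extremes exclude each other, and the e-cells number
   [#|Fr| - 1 + delta]. *)
have excl : ~~ ((K0 == 0%VS) && (K0 == fullv)).
  by apply: contra full_neq0 => /andP[/eqP->]; rewrite eq_sym.
move: Fr_gt1 excl; move: (_ && _) (K0 == 0%VS) (K0 == fullv) #|Fr|; clear.
by move=> b [] [] r; case: b => //=; lia.
Qed.
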